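(* Let $G$ be the graph of a local flat folding of the plane. Then the special vertex $\infty$ (if present in $G$) is not an articulation vertex of $G$.
   Context: Local flat folding: a continuous function $\varphi:\mathbb{R}^2\to\mathbb{R}^2$ such that every point $p$ of the plane is of one of the following three types, and at least one point is a vertex point (the number of vertex points is not required to be finite). (1) Unfolded point: $p$ has a neighborhood mapped by $\varphi$ in a distance-preserving way. (2) Crease point: $p$ has a neighborhood $N$ that can be covered by two subsets, each containing $p$ and each mapped by $\varphi$ in a different distance-preserving way. (Necessarily the boundary between the subsets is a line through $p$, and the two isometries are reflections of each other across the image of this line; points of $N$ on this line are also crease points and the other points of $N$ are unfolded points.) (3) Vertex point: $p$ has a neighborhood $N$ that can be covered by finitely many (at least three) subsets, each containing $p$ and each mapped by $\varphi$ in a distance-preserving way, with at least three distinct isometries among these subsets. (Necessarily each subset is a wedge with apex $p$; points of $N$ other than $p$ on the rays between pairs of wedges are crease points and the remaining points of $N$ other than $p$ are unfolded points.) Graph of a local flat folding $\varphi$: the multigraph $G$ with a vertex for each vertex point of $\varphi$ and, if $\varphi$ includes any infinite rays of crease points, one additional special vertex $\infty$. Two vertex points are joined by an edge when the line segment between them consists (apart from its endpoints) only of crease points. For each ray with apex at a vertex point $p$ all of whose points other than the apex are crease points, there is an edge between $p$ and $\infty$ (so there may be several parallel edges between $p$ and $\infty$, but at most one edge between any two vertex points). An articulation vertex is a vertex whose removal causes the remaining graph to be disconnected. *)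

(* Defs.v *)
From mathcomp Require Import all_boot all_order all_algebra.
From mathcomp Require Import all_classical all_reals all_analysis.
From Stdlib Require Import Relation_Operators.
Import Order.TTheory GRing.Theory Num.Theory numFieldNormedType.Exports.

Set Implicit Arguments.
Unset Strict Implicit.
Unset Printing Implicit Defensive.

Local Open Scope classical_set_scope.
Local Open Scope ring_scope.

(* The library norm on [R * R] is the sup norm. It induces the usual topology,
   so [nbhs] and [continuous] can be used as they are, but the metric notions
   below need the Euclidean distance. *)
Notation plane R := (R * R)%type.

Section Plane.
Variable R : realType.
Implicit Types (p q d : plane R) (A : set (plane R)).

Definition edist p q : R :=
  Num.sqrt ((p.1 - q.1) ^+ 2 + (p.2 - q.2) ^+ 2).

Definition distance_preserving_on A (f : plane R -> plane R) : Prop :=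
  forall p q, A p -> A q -> edist (f p) (f q) = edist p q.

Definition plane_isometry (f : plane R -> plane R) : Prop :=
  distance_preserving_on setT f.

Definition open_segment p q : set (plane R) :=
  [set x | exists t : R, [/\ 0 < t, t < 1 & x = p + t *: (q - p)]].

Definition open_ray p d : set (plane R) :=
  [set x | exists t : R, 0 < t /\ x = p + t *: d].

Lemma open_segmentC p q : open_segment p q = open_segment q p.
Proof.
suff sub a b : open_segment a b `<=` open_segment b a.
  by rewrite eqEsubset; split; apply: sub.
move=> x [t [t0 t1 ->]]; exists (1 - t); split.
- by rewrite subr_gt0.
- by rewrite ltrBlDr ltrDl.
by rewrite scalerBl scale1r -scalerN opprB addrA subrKC.
Qed.

End Plane.

Section Folding.
Variable R : realType.
Variable phi : plane R -> plane R.
Implicit Types (p q : plane R).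

(* "[A] is mapped by [phi] in the distance-preserving way [f]": a
   distance-preserving map on [A] is the restriction of an isometry [f] of the
   whole plane, and two subsets are mapped in different ways when the
   isometries are different. *)
Definition folded_by (A : set (plane R)) (f : plane R -> plane R) : Prop :=
  plane_isometry f /\ forall x, A x -> phi x = f x.

Definition unfolded_point p : Prop :=
  exists N, nbhs p N /\ distance_preserving_on N phi.

(* The three types of points are meant to exclude one another. Since the
   subsets of a cover are arbitrary, without the negative clauses below adding
   the subset [[set p]] to a cover (with any other isometry that agrees with
   [phi] at [p]) would make every unfolded point a crease point and a vertex
   point. With these clauses the pieces of a cover can differ from half-planes
   (resp. wedges) only in inessential ways. *)
Definition crease_point p : Prop :=
  ~ unfolded_point p /\
  exists (A1 A2 : set (plane R)) (f1 f2 : plane R -> plane R),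
    [/\ nbhs p (A1 `|` A2), A1 p /\ A2 p,
        folded_by A1 f1, folded_by A2 f2 & f1 <> f2].

Definition vertex_point p : Prop :=
  [/\ ~ unfolded_point p, ~ crease_point p &
  exists (n : nat) (A : 'I_n -> set (plane R))
         (f : 'I_n -> plane R -> plane R),
    [/\ (3 <= n)%N,
        nbhs p (\bigcup_i A i),
        forall i, A i p,
        forall i, folded_by (A i) (f i) &
        exists i j k, [/\ f i <> f j, f i <> f k & f j <> f k]]].

Definition local_flat_folding : Prop :=
  [/\ continuous phi,
      forall p, [\/ unfolded_point p, crease_point p | vertex_point p] &
      exists p, vertex_point p].

End Folding.

(* A multigraph with vertices drawn from [V]; its edges are the [e : E] that
   join some pair of vertices, so that parallel edges are distinct elements of
   [E] joining the same pair. *)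
Record multigraph (V E : Type) := Multigraph {
  vertices : set V;
  joins : E -> V -> V -> Prop;
  joins_sym : forall e u v, joins e u v -> joins e v u;
  joins_vertex : forall e u v, joins e u v -> vertices u
}.

Section Multigraph.
Variables V E : Type.
Implicit Types (G : multigraph V E) (u v x : V) (e : E).

Section Remove.
Variables (G : multigraph V E) (x : V).

Definition remove_joins e u v : Prop := [/\ joins G e u v, u <> x & v <> x].

Lemma remove_joins_sym e u v : remove_joins e u v -> remove_joins e v u.
Proof. by case=> /(@joins_sym _ _ G) Gvu ux vx; split. Qed.

Lemma remove_joins_vertex e u v :
  remove_joins e u v -> (vertices G `\ x) u.
Proof. by case=> /(@joins_vertex _ _ G) Gu ux _; split. Qed.

Definition remove_vertex : multigraph V E :=
  Multigraph remove_joins_sym remove_joins_vertex.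

End Remove.

Definition adjacent G u v : Prop := exists e, joins G e u v.

Definition graph_connected G : Prop :=
  forall u v, vertices G u -> vertices G v ->
    clos_refl_trans V (adjacent G) u v.

Definition articulation_vertex G x : Prop :=
  vertices G x /\ ~ graph_connected (remove_vertex G x).

End Multigraph.

(* [Some p] is the vertex for the vertex point [p]; [None] is the special
   vertex at infinity. An edge is represented by the open segment or open ray
   that it is drawn as. *)
Section FoldingGraph.
Variables (R : realType) (phi : plane R -> plane R).

Definition folding_vertices : set (option (plane R)) :=
  [set v | match v with
           | Some p => vertex_point phi p
           | None => exists p d,
               d <> 0 /\ open_ray p d `<=` [set x | crease_point phi x]
           end].

Definition ray_edge (e : set (plane R)) (p : plane R) : Prop :=
  exists d, [/\ vertex_point phi p, d <> 0, e = open_ray p d &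
                e `<=` [set x | crease_point phi x]].

Definition segment_edge (e : set (plane R)) (p q : plane R) : Prop :=
  [/\ vertex_point phi p /\ vertex_point phi q, p <> q, e = open_segment p q &
      e `<=` [set x | crease_point phi x]].

Definition folding_joins (e : set (plane R)) (u v : option (plane R)) : Prop :=
  match u, v with
  | Some p, Some q => segment_edge e p q
  | Some p, None | None, Some p => ray_edge e p
  | None, None => False
  end.

Lemma folding_joins_sym e u v : folding_joins e u v -> folding_joins e v u.
Proof.
case: u v => [p|] [q|] //= [[vp vq] pq -> cr]; split=> //.
- by move=> qp; apply: pq.
- exact: open_segmentC.
Qed.

Lemma folding_joins_vertex e u v : folding_joins e u v -> folding_vertices u.
Proof.
case: u v => [p|] [q|] //=; first by case=> -[].
- by case=> d [].
- by case=> d [_ d0 -> cr]; exists q, d.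
Qed.

Definition folding_graph : multigraph (option (plane R)) (set (plane R)) :=
  Multigraph folding_joins_sym folding_joins_vertex.

End FoldingGraph.

(* Main.v *)
Require Import Defs.
From mathcomp Require Import all_boot all_order all_algebra.
From mathcomp Require Import all_classical all_reals all_analysis.
From mathcomp Require Import ring lra.
From Stdlib Require Import Relation_Operators.
Import Order.TTheory GRing.Theory Num.Theory numFieldNormedType.Exports.
(* The library also has an [edist], which this import hides again. *)
Import Defs.

Set Implicit Arguments.
Unset Strict Implicit.
Unset Printing Implicit Defensive.

Local Open Scope classical_set_scope.
Local Open Scope ring_scope.

(* The folding [phi] is 1-Lipschitz, and isometric along segments of unfolded
   points. Hence at a vertex point no open half disc consists of unfolded
   points: otherwise [phi] would stretch the two opposite boundary directions to
   their full length, which determines it nearby up to one reflection. So the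
   set of folded points looks locally like a line or like a star with all angles
   less than a straight angle, and the faces (components of its complement) are
   convex. Consequently no whole line consists of crease points: the face next
   to it would be a strip whose other side is again such a line, and repeating
   this leaves no room for a vertex point. Now suppose that the folded points
   are split into two relatively open parts, and choose [x] and [y] in different
   parts such that the segment between them lies in one face. The rays from its
   midpoint meet the boundary of the face in a part that depends locally
   constantly on the direction, so on either side of the segment some ray stays
   in the face. By convexity these two rays are opposite, so the face is a
   strip bounded by a line of creases, which is impossible. So the folded points
   form a connected set. The points on the edges, finite or infinite, at the
   vertices of one component of the graph without the vertex at infinity are a
   relatively open and closed part of it, hence all of it. *)

(** * Induction and connectedness on a real interval *)

Section RealLine.
Variable R : realType.
Implicit Types (P : R -> Prop) (a b e s t : R).

Lemma positive_below a b : 0 < a -> 0 < b -> exists m, [/\ 0 < m, m <= a & m <= b].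
Proof.
move=> a0 b0; exists (Num.min a b).
by rewrite lt_min a0 b0 !ge_min !lexx orbT.
Qed.

Lemma nonneg_left_of t e : 0 < t -> 0 < e -> exists s, [/\ 0 <= s, t - e < s & s < t].
Proof.
move=> t0 e0; exists (Num.max 0 (t - e / 2)).
by case: (leP 0 (t - e / 2)) => ?; split; lra.
Qed.

(** The supremum [m] of the [t] with [P] on all of [[0, t]] is reached by the last hypothesis, and
    passed by the other one unless [m = b]. *)
Lemma real_induction P b : 0 <= b -> P 0 ->
  (forall t, 0 <= t < b -> (forall s, 0 <= s <= t -> P s) ->
     exists2 e, 0 < e & forall s, t < s < t + e -> s <= b -> P s) ->
  (forall t, 0 < t <= b -> (forall s, 0 <= s < t -> P s) -> P t) ->
  forall t, 0 <= t <= b -> P t.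
Proof.
move=> b0 P0 right left.
pose S := [set t | 0 <= t <= b /\ forall s, 0 <= s <= t -> P s].
have S0 : S 0 by split=> [|s ?]; [lra | have -> : s = 0 by lra].
have Sb : has_ubound S by exists b => t [? _]; lra.
set m := sup S; have m0 : 0 <= m by exact: ub_le_sup.
have mb : m <= b by apply: ge_sup; [exists 0 | move=> t [? _]; lra].
have below s : 0 <= s < m -> P s.
  move=> /andP[s0 sm].
  have [|t [_ Pt] st] := @sup_adherent _ S (m - s) _ (conj (ex_intro _ _ S0) Sb).
    lra.
  by apply: Pt; move: st; rewrite -/m; lra.
have Pm s : 0 <= s <= m -> P s.
  move=> /andP[s0]; rewrite le_eqVlt => /predU1P[->|sm]; last by apply: below; lra.
  move: m0; rewrite le_eqVlt => /predU1P[<- //|m0].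
  by apply: left below; lra.
have [mb'|mb'] := ltP m b; last by move=> t ?; apply: Pm; lra.
have [|e e0 Pe] := right m _ Pm; first lra.
pose t := Num.min b (m + e / 2).
have [tb te mt] : [/\ t <= b, t < m + e & m < t].
  by rewrite /t; case: (leP b (m + e / 2)) => h; split; lra.
have : S t.
  split=> [|s /andP[s0 st]]; first lra.
  have [sm|sm] := leP s m; first by apply: Pm; lra.
  by apply: Pe; lra.
by move/(ub_le_sup Sb); rewrite -/m; lra.
Qed.

(** Without a first point, a point preceded by none satisfying [P] does not satisfy [P] either, and
    real induction refutes [P b]. *)
Lemma first_point P b : 0 <= b -> P b ->
  (forall t, 0 <= t <= b -> ~ P t ->
     exists2 e, 0 < e & forall s, `|s - t| < e -> ~ P s) ->
  exists2 t, 0 <= t <= b & P t /\ forall s, 0 <= s < t -> ~ P s.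
Proof.
move=> b0 Pb opn; apply: contrapT => no.
suff : ~ P b by [].
apply: (@real_induction (fun t => ~ P t) b) => //; last by lra.
- by move=> P0; apply: no; exists 0; [lra | split=> // s ?; lra].
- move=> t t0 nP; have [||e e0 h] := opn t; [lra|apply: nP; lra|].
  by exists e => // s st sb; apply: h; rewrite ltr_norml; lra.
- by move=> t t0 nP Pt; apply: no; exists t => //; lra.
Qed.

(** Connectedness of the interval, in the form that continuation arguments along a segment need. *)
Lemma locally_constant P b : 0 <= b ->
  (forall t, 0 <= t <= b -> exists2 e, 0 < e &
     forall s, 0 <= s <= b -> `|s - t| < e -> (P s <-> P t)) ->
  P 0 -> forall t, 0 <= t <= b -> P t.
Proof.
move=> b0 loc P0; apply: real_induction => //.
- move=> t t0 Pt; have [|e e0 h] := loc t; first lra.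
  exists e => // s st sb; apply/h; [lra|by rewrite ltr_norml; lra|].
  by apply: Pt; lra.
- move=> t t0 Pt; have [|e e0 h] := loc t; first lra.
  have [|s [s0 ts st]] := @nonneg_left_of t e _ e0; first by case/andP: t0.
  apply/(h s); [lra|by rewrite ltr_norml; lra|].
  by apply: Pt; lra.
Qed.

End RealLine.

(** * Scalar and cross products in the plane *)

Section Geometry.
Variable R : realType.
Implicit Types (p q x y c d u v w : plane R) (a b e s t : R).

Definition dot u v := u.1 * v.1 + u.2 * v.2.
Definition cross u v := u.1 * v.2 - u.2 * v.1.
Definition perp u : plane R := (- u.2, u.1).

Lemma planeP u v : u.1 = v.1 -> u.2 = v.2 -> u = v.
Proof. by case: u v => ? ? [? ?] /= -> ->. Qed.

Lemma planeE : (forall u v, (u + v).1 = u.1 + v.1) *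
  (forall u v, (u + v).2 = u.2 + v.2) * (forall u, (- u).1 = - u.1) *
  (forall u, (- u).2 = - u.2) * (forall t u, (t *: u).1 = t * u.1) *
  (forall t u, (t *: u).2 = t * u.2) *
  (forall u, (perp u).1 = - u.2) * (forall u, (perp u).2 = u.1) *
  ((0 : plane R).1 = 0) * ((0 : plane R).2 = 0).
Proof. by []. Qed.

End Geometry.

Ltac plane_ring := apply: planeP; rewrite !planeE; ring.
Ltac dot_ring := rewrite /dot /cross ?planeE; ring.

(** * Isometries of the plane *)

Section Isometries.
Variable R : realType.
Implicit Types (p q x y c d u v w : plane R) (a b e s t : R).

Lemma dot_ge0 u : 0 <= dot u u.
Proof. by rewrite /dot -!expr2 addr_ge0 ?sqr_ge0. Qed.

Lemma dot_eq0 u : (dot u u == 0) = (u == 0).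
Proof.
case: u => u1 u2; rewrite /dot /= -!expr2 paddr_eq0 ?sqr_ge0 // !sqrf_eq0.
by rewrite -xpair_eqE.
Qed.

Lemma dot_gt0 u : u != 0 -> 0 < dot u u.
Proof. by move=> u0; rewrite lt_neqAle dot_ge0 eq_sym dot_eq0 u0. Qed.

Lemma lagrange u v : dot u v ^+ 2 + cross u v ^+ 2 = dot u u * dot v v.
Proof. dot_ring. Qed.

Lemma plane_decomp c u :
  c != 0 -> u = (dot c c)^-1 *: (dot c u *: c + cross c u *: perp c).
Proof.
move=> /dot_gt0 /lt0r_neq0 c0; apply: (scalerI c0); rewrite scalerA mulfV // scale1r.
by apply: planeP; dot_ring.
Qed.

Lemma cross_eq0 d u : d != 0 -> cross d u = 0 -> exists t, u = t *: d.
Proof.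
move=> d0 h; exists (dot d u / dot d d); rewrite {1}(plane_decomp u d0) h.
by rewrite scale0r addr0 scalerA mulrC.
Qed.

Lemma edistE p q : edist p q = Num.sqrt (dot (p - q) (p - q)).
Proof. by []. Qed.

Lemma edist_ge0 p q : 0 <= edist p q.
Proof. exact: sqrtr_ge0. Qed.

Lemma edistC p q : edist p q = edist q p.
Proof. by rewrite !edistE; congr Num.sqrt; dot_ring. Qed.

Lemma edist_sqr p q : edist p q ^+ 2 = dot (p - q) (p - q).
Proof. by rewrite edistE sqr_sqrtr // dot_ge0. Qed.

Lemma eq_edist p q x y :
  edist p q = edist x y <-> dot (p - q) (p - q) = dot (x - y) (x - y).
Proof. by split=> h; [rewrite -!edist_sqr h | rewrite !edistE h]. Qed.

Lemma le_edist p q x y :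
  (edist p q <= edist x y) = (dot (p - q) (p - q) <= dot (x - y) (x - y)).
Proof. by rewrite -!edist_sqr ler_sqr // nnegrE edist_ge0. Qed.

Lemma edist_triangle q p x : edist p x <= edist p q + edist q x.
Proof.
have a0 := edist_ge0 p q; have b0 := edist_ge0 q x.
have a2 := edist_sqr p q; have b2 := edist_sqr q x; have c2 := edist_sqr p x.
set a := edist p q in a0 a2 *; set b := edist q x in b0 b2 *.
(* The Cauchy-Schwarz inequality, from the identity of Lagrange. *)
have cs : dot (p - q) (q - x) <= a * b.
  rewrite leNgt; apply/negP => h.
  have := lagrange (p - q) (q - x); rewrite -a2 -b2.
  have := sqr_ge0 (cross (p - q) (q - x)); have := mulr_ge0 a0 b0.
  by nra.
rewrite -ler_sqr ?nnegrE ?edist_ge0 ?addr_ge0 // c2.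
have -> : dot (p - x) (p - x) =
  dot (p - q) (p - q) + 2 * dot (p - q) (q - x) + dot (q - x) (q - x) by dot_ring.
by rewrite -a2 -b2; lra.
Qed.

Lemma edist_line x w s t :
  edist (x + s *: w) (x + t *: w) = `|s - t| * edist w 0.
Proof.
rewrite !edistE -(sqrtr_sqr (s - t)) -sqrtrM ?sqr_ge0 //.
by congr Num.sqrt; dot_ring.
Qed.

(* The two isometries that map [p] to [q] and [p + d] to [q + c]: [s = 1]
   preserves and [s = -1] reverses the orientation. *)
Definition bend p q d c s x : plane R :=
  q + (dot d d)^-1 *: (dot d (x - p) *: c + (s * cross d (x - p)) *: perp c).

Lemma bend_isometry p q d c s :
  d != 0 -> dot c c = dot d d -> s ^+ 2 = 1 -> plane_isometry (bend p q d c s).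
Proof.
move=> /dot_gt0 /lt0r_neq0 d0 cd s1 x y _ _; apply/eq_edist.
transitivity ((dot d d)^-1 ^+ 2 * dot c c *
  (dot d (x - y) ^+ 2 + s ^+ 2 * cross d (x - y) ^+ 2)).
  by rewrite /bend; move: (dot d d)^-1 => k; dot_ring.
by rewrite s1 mul1r lagrange cd; field.
Qed.

Lemma bend_axis p q d c s t x :
  cross d (x - p) = 0 -> bend p q d c s x = bend p q d c t x.
Proof. by rewrite /bend => ->; rewrite !mulr0. Qed.

Lemma bend_neq p q d c x : d != 0 -> dot c c = dot d d ->
  cross d (x - p) != 0 -> bend p q d c 1 x <> bend p q d c (-1) x.
Proof.
move=> d0 cd x0 /addrI /(scalerI (invr_neq0 (lt0r_neq0 (dot_gt0 d0)))) /addrI.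
have c0 : c != 0 by rewrite -dot_eq0 cd dot_eq0.
move/eqP; rewrite -subr_eq0 -scalerBl scaler_eq0 => /orP[/eqP h|].
  by move/eqP: x0; apply; lra.
rewrite -dot_eq0; have -> : dot (perp c) (perp c) = dot c c by dot_ring.
by rewrite dot_eq0 (negPf c0).
Qed.

(** The component of [y - q] along [c] is given, and the length then determines the perpendicular
    component up to sign. *)
Lemma bend_cases p q d c x y : d != 0 -> dot c c = dot d d ->
  dot c (y - q) = dot d (x - p) -> dot (y - q) (y - q) = dot (x - p) (x - p) ->
  y = bend p q d c 1 x \/ y = bend p q d c (-1) x.
Proof.
move=> d0 cd h1 h2.
have c0 : c != 0 by rewrite -dot_eq0 cd dot_eq0.
have E : y = q + (dot d d)^-1 *: (dot d (x - p) *: c + cross c (y - q) *: perp c).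
  by rewrite -h1 -cd -plane_decomp // subrKC.
have : cross c (y - q) ^+ 2 = cross d (x - p) ^+ 2.
  have := lagrange c (y - q); have := lagrange d (x - p); rewrite cd h1 h2; lra.
move/eqP; rewrite eqf_sqr => /orP[] /eqP h; [left|right];
  by rewrite {1}E h /bend ?mul1r ?mulN1r.
Qed.

(** By polarization an isometry preserves scalar products of differences. So [perp d] goes to plus
    or minus [perp] of the image of [d], and every other vector is determined by its scalar products
    with these two. *)
Lemma isometry_bend f p d : plane_isometry f -> d != 0 ->
  dot (f (p + d) - f p) (f (p + d) - f p) = dot d d /\
  exists s, [/\ s = 1 \/ s = -1 &
    forall x, f x = bend p (f p) d (f (p + d) - f p) s x].
Proof.
move=> isof d0; pose F u := f (p + u) - f p.
have dF u v : dot (F u) (F v) = dot u v.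
  have h x y : dot (f x - f y) (f x - f y) = dot (x - y) (x - y).
    by apply/eq_edist; apply: isof.
  have h1 := h (p + u) p; have h2 := h (p + v) p; have h3 := h (p + u) (p + v).
  have e1 : p + u - p = u by plane_ring.
  have e2 : p + v - p = v by plane_ring.
  have e3 : p + u - (p + v) = u - v by plane_ring.
  rewrite e1 in h1; rewrite e2 in h2; rewrite e3 in h3.
  have : dot (f (p + u) - f (p + v)) (f (p + u) - f (p + v)) =
    dot (F u) (F u) + dot (F v) (F v) - 2 * dot (F u) (F v) by rewrite /F; dot_ring.
  have : dot (u - v) (u - v) = dot u u + dot v v - 2 * dot u v by dot_ring.
  rewrite /F in h1 h2 *; lra.
split; first exact: dF.
have c0 : F d != 0 by rewrite -dot_eq0 dF dot_eq0.
have N0 := lt0r_neq0 (dot_gt0 d0).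
have F0 x : f x = f p + F (x - p) by rewrite /F !subrKC.
have [s [s1 hs]] : exists s, (s = 1 \/ s = -1) /\ F (perp d) = s *: perp (F d).
  have h1 : dot (F d) (F (perp d)) = 0 by rewrite dF; dot_ring.
  have h2 : cross (F d) (F (perp d)) ^+ 2 = dot d d ^+ 2.
    have := lagrange (F d) (F (perp d)); rewrite h1 !dF.
    have -> : dot (perp d) (perp d) = dot d d by dot_ring.
    lra.
  have E := plane_decomp (F (perp d)) c0; rewrite h1 scale0r add0r scalerA dF in E.
  move/eqP: h2; rewrite eqf_sqr => /orP[] /eqP h; rewrite h in E.
    by exists 1; split; [left|rewrite E mulVf].
  by exists (-1); split; [right|rewrite E mulrN mulVf].
exists s; split=> // x; rewrite {1}F0 /bend; congr (_ + _).
rewrite {1}(plane_decomp (F (x - p)) c0) !dF; congr (_ *: (_ + _ *: _)).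
have -> : cross d (x - p) = dot (perp d) (x - p) by dot_ring.
rewrite -[in RHS](dF (perp d)) hs.
have -> : dot (s *: perp (F d)) (F (x - p)) = s * cross (F d) (F (x - p)) by dot_ring.
by case: s1 => ->; ring.
Qed.

End Isometries.

(** * Local structure of a folding *)

Section NormedPlane.
Variable R : realType.
Implicit Types (p q x y c d u v w : plane R) (a b e s t : R).

Lemma nbhs_plane p (N : set (plane R)) :
  nbhs p N <-> exists2 e, 0 < e & forall x, `|x - p| < e -> N x.
Proof.
split=> [/(nbhs_normP p N).1[e e0 h]|[e e0 h]].
  by exists e => // x px; apply: h; rewrite /= distrC.
by apply: (nbhs_normP p N).2; exists e => // x /=; rewrite distrC => /h.
Qed.

Lemma edist_le_norm p q : edist p q <= 2 * `|p - q|.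
Proof.
have n0 : 0 <= `|p - q| := normr_ge0 _.
have h : `|(p - q).1| <= `|p - q| /\ `|(p - q).2| <= `|p - q|.
  by rewrite prod_normE !le_max !lexx orbT.
case: h; rewrite !ler_norml => h1 h2.
rewrite -ler_sqr ?nnegrE ?edist_ge0 ?mulr_ge0 // edist_sqr /dot.
by nra.
Qed.

Lemma line_near x w e : 0 < e -> exists2 r, 0 < r &
  forall s t, `|s - t| < r -> `|x + s *: w - (x + t *: w)| < e.
Proof.
move=> e0; have w1 : 0 < `|w| + 1 by rewrite ltr_pwDr.
exists (e / (`|w| + 1)); first exact: divr_gt0.
move=> s t st; have -> : x + s *: w - (x + t *: w) = (s - t) *: w by plane_ring.
rewrite normrZ; move: st; rewrite ltr_pdivlMr // => /le_lt_trans; apply.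
by rewrite ler_wpM2l // lerDl.
Qed.

End NormedPlane.

Section LocalFolding.
Variables (R : realType) (phi : plane R -> plane R).
Hypothesis Hphi : local_flat_folding phi.
Implicit Types (p q x y c d u v w : plane R) (a b e s t : R).

Local Notation U := (unfolded_point phi).

Lemma fold_cases p :
  [\/ U p, crease_point phi p | vertex_point phi p].
Proof. by case: Hphi. Qed.

Lemma unfolded_box p : U p -> exists2 e, 0 < e &
  forall x y, `|x - p| < e -> `|y - p| < e -> edist (phi x) (phi y) = edist x y.
Proof.
by move=> [N [/nbhs_plane[e e0 eN] h]]; exists e => // x y /eN ? /eN ?; apply: h.
Qed.

Lemma unfolded_open p : U p -> exists2 e, 0 < e & forall x, `|x - p| < e -> U x.
Proof.
move=> /unfolded_box[e e0 h]; exists (e / 2) => [|x xp]; first by rewrite divr_gt0.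
exists [set y | `|y - x| < e / 2]; split.
  by apply/nbhs_plane; exists (e / 2); rewrite ?divr_gt0.
have near y : `|y - x| < e / 2 -> `|y - p| < e.
  by have := ler_distD x y p; lra.
by move=> y z /= /near ? /near ?; apply: h.
Qed.

(** A common form for the covers at crease and vertex points. Every piece contains [p], so each
    isometry agrees with [phi] there. *)
Lemma folded_maps p : ~ U p -> exists n (f : 'I_n -> plane R -> plane R) e,
  [/\ 0 < e, forall i, plane_isometry (f i) /\ f i p = phi p &
      forall x, `|x - p| < e -> exists i, phi x = f i x].
Proof.
move=> nU; case: (fold_cases p) => [//|[_ [A1 [A2 [f1 [f2 []]]]]]|[_ _ [n [A [f []]]]]].
  move=> /nbhs_plane[e e0 eA] [A1p A2p] [i1 h1] [i2 h2] _.
  exists 2, (fun i => if i == ord0 then f1 else f2), e; split=> //.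
    by move=> i; case: ifP => _; split; rewrite // -?h1 -?h2.
  by move=> x /eA[/h1 ?|/h2 ?]; [exists ord0|exists ord_max].
move=> _ /nbhs_plane[e e0 eA] Ap h _; exists n, f, e; split=> //.
  by move=> i; have [i1 hi] := h i; split; rewrite // -hi.
by move=> x /eA[i _ Ai]; exists i; have [_ hi] := h i; apply: hi.
Qed.

(** All local isometries agree with [phi] at [p], so distances to [p] are kept whatever the shape of
    the pieces. *)
Lemma radial p : exists2 e, 0 < e &
  forall x, `|x - p| < e -> edist (phi x) (phi p) = edist x p.
Proof.
have [/unfolded_box[e e0 h]|/folded_maps[n [f [e [e0 fi h]]]]] := pselect (U p).
  by exists e => // x xp; apply: h => //; rewrite subrr normr0.
exists e => // x /h[i ->]; have [isof <-] := fi i.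
exact: isof.
Qed.

(** By [radial], sufficiently short steps along the segment keep their length; the triangle
    inequality adds them up. *)
Lemma fold_lipschitz x y : edist (phi x) (phi y) <= edist x y.
Proof.
pose w := x - y; pose g t := y + t *: w.
pose P t := edist (phi (g t)) (phi (g 0)) <= t * edist w 0.
suff main : forall t, 0 <= t <= 1 -> P t.
  have -> : edist x y = 1 * edist w 0.
    by rewrite mul1r !edistE; congr Num.sqrt; rewrite /w; dot_ring.
  have := main 1; rewrite /P /g scale0r addr0 scale1r subrKC; apply.
  by rewrite lexx ler01.
have close t : exists2 r, 0 < r & forall s, `|s - t| < r ->
    edist (phi (g s)) (phi (g t)) = `|s - t| * edist w 0.
  have [e e0 h] := radial (g t); have [r r0 hr] := line_near y w e0.
  by exists r => // s st; rewrite -(edist_line y); apply: h; apply: hr.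
apply: real_induction => //.
- rewrite /P mul0r edistE subrr.
  by have -> : dot (0 : plane R) 0 = 0; [dot_ring|rewrite sqrtr0].
- move=> t t0 Pt; have [r r0 hr] := close t; exists r => // s st _.
  apply: le_trans (edist_triangle (phi (g t)) _ _) _.
  rewrite hr; last by rewrite ltr_norml; lra.
  have : P t by apply: Pt; lra.
  by rewrite /P ger0_norm; lra.
- move=> t t0 Pt; have [r r0 hr] := close t.
  have [|s [s0 ts st]] := @nonneg_left_of _ t r _ r0; first by case/andP: t0.
  apply: le_trans (edist_triangle (phi (g s)) _ _) _.
  rewrite edistC hr; last by rewrite ltr_norml; lra.
  have : P s by apply: Pt; lra.
  by rewrite /P ler0_norm; lra.
Qed.

(** The values of the two isometries at [x] are a positive distance apart, so by the Lipschitz bound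
    [phi] cannot jump from one to the other near [x]. *)
Lemma fold_agree_near f1 f2 x e : 0 < e ->
  plane_isometry f1 -> plane_isometry f2 ->
  (forall y, `|y - x| < e -> phi y = f1 y \/ phi y = f2 y) ->
  phi x = f1 x -> f1 x <> f2 x ->
  exists2 r, 0 < r & forall y, `|y - x| < r -> phi y = f1 y.
Proof.
move=> e0 i1 i2 h x1 x12.
have D0 : 0 < edist (f1 x) (f2 x).
  rewrite lt_neqAle edist_ge0 andbT eq_sym; apply: contra_notN x12 => /eqP E.
  have /eqP := edist_sqr (f1 x) (f2 x); rewrite E expr0n /= eq_sym dot_eq0 subr_eq0.
  by move/eqP.
(* A jump at [y] would bound this distance by twice [edist y x], and comparing with the sup norm
   costs another factor 2. *)
exists (Num.min e (edist (f1 x) (f2 x) / 4)).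
  by rewrite lt_min e0 divr_gt0.
move=> y; rewrite lt_min => /andP[/h[//|y2] yD]; exfalso.
have := edist_triangle (f2 y) (f1 x) (f2 x); rewrite (i2 y x) //.
have := fold_lipschitz y x; rewrite y2 x1 (edistC (f1 x) (f2 y)).
have := edist_le_norm y x.
lra.
Qed.

Lemma fold_agree_unfolded f1 f2 x e : 0 < e ->
  plane_isometry f1 -> plane_isometry f2 ->
  (forall y, `|y - x| < e -> phi y = f1 y \/ phi y = f2 y) ->
  f1 x <> f2 x -> U x.
Proof.
move=> e0 i1 i2 h x12.
have [f [r [isof r0 hr]]] :
    exists f r, [/\ plane_isometry f, 0 < r & forall y, `|y - x| < r -> phi y = f y].
  have [|x1|x2] := h x; first by rewrite subrr normr0.
    by have [r r0 hr] := fold_agree_near e0 i1 i2 h x1 x12; exists f1, r.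
  have h' y : `|y - x| < e -> phi y = f2 y \/ phi y = f1 y by move/h => []; [right|left].
  by have [r r0 hr] := fold_agree_near e0 i2 i1 h' x2 (nesym x12); exists f2, r.
exists [set y | `|y - x| < r]; split; first by apply/nbhs_plane; exists r.
by move=> y z /= /hr -> /hr ->; apply: isof.
Qed.

(** Near every point of the segment the image moves affinely with a velocity as long as [w]. The
    velocity is locally constant, hence constant. *)
Lemma unfolded_segment x w : (forall t, 0 <= t <= 1 -> U (x + t *: w)) ->
  edist (phi (x + w)) (phi x) = edist (x + w) x.
Proof.
move=> Useg; pose psi t := phi (x + t *: w).
pose affine v t := exists2 r, 0 < r &
  forall s, `|s - t| < r -> psi s = psi t + (s - t) *: v.
have aff t : 0 <= t <= 1 -> exists v, dot v v = dot w w /\ affine v t.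
  move=> /Useg /unfolded_box[e e0 h]; have [r r0 hr] := line_near x w e0.
  have D s s' : `|s - t| < r -> `|s' - t| < r ->
      dot (psi s - psi s') (psi s - psi s') = (s - s') ^+ 2 * dot w w.
    move=> st st'.
    have /eq_edist -> := h _ _ (hr _ _ st) (hr _ _ st').
    by dot_ring.
  pose k := r / 2; have k0 : k != 0 by rewrite lt0r_neq0 // divr_gt0.
  have kr : `|t + k - t| < r by rewrite ltr_norml /k; lra.
  have tr : `|t - t| < r by rewrite subrr normr0.
  exists (k^-1 *: (psi (t + k) - psi t)); split.
    transitivity (k^-1 ^+ 2 * dot (psi (t + k) - psi t) (psi (t + k) - psi t)).
      by dot_ring.
    by rewrite D //; field.
  exists r => // s st.
  have h1 := D _ _ st tr; have h2 := D _ _ kr tr; have h3 := D _ _ st kr.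
  have : dot (psi s - psi (t + k)) (psi s - psi (t + k)) =
    dot (psi s - psi t) (psi s - psi t) + dot (psi (t + k) - psi t) (psi (t + k) - psi t)
    - 2 * dot (psi s - psi t) (psi (t + k) - psi t) by dot_ring.
  rewrite h1 h2 h3 => h4.
  (* The equality case of Cauchy-Schwarz: the three distances between [psi s], [psi t] and
     [psi (t + k)] make them collinear, so this difference has length zero. *)
  have : dot (k *: (psi s - psi t) - (s - t) *: (psi (t + k) - psi t))
     (k *: (psi s - psi t) - (s - t) *: (psi (t + k) - psi t)) == 0.
    apply/eqP; transitivity (k ^+ 2 * dot (psi s - psi t) (psi s - psi t)
     + (s - t) ^+ 2 * dot (psi (t + k) - psi t) (psi (t + k) - psi t)
     - k * (s - t) * (2 * dot (psi s - psi t) (psi (t + k) - psi t))); first by dot_ring.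
    by rewrite (_ : 2 * _ = 2 * k * (s - t) * dot w w) ?h1 ?h2; [ring|lra].
  rewrite dot_eq0 subr_eq0 => /eqP E.
  apply: (scalerI k0); transitivity (k *: psi t + k *: (psi s - psi t)).
    by plane_ring.
  by rewrite E; apply: planeP; rewrite !planeE; field.
have [|v [vw [r r0 hr]]] := aff 0; first by rewrite lexx ler01.
have loc t u : affine u t -> exists2 e, 0 < e & forall s, `|s - t| < e -> affine u s.
  move=> [e e0 h]; exists (e / 2) => [|s st]; first by rewrite divr_gt0.
  exists (e / 2) => [|s' ss]; first by rewrite divr_gt0.
  rewrite (h s) 1?(h s'); first by plane_ring.
    by have := ler_distD s s' t; lra.
  by lra.
have uniq u u' t : affine u t -> affine u' t -> u = u'.
  move=> [e e0 h] [e' e'0 h']; have [m [m0 me me']] := positive_below e0 e'0.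
  pose k := m / 2; have [k0 ke ke'] : [/\ 0 < k, k < e & k < e'].
    by rewrite /k; split; lra.
  have kt : `|t + k - t| = k by rewrite addrAC subrr add0r gtr0_norm.
  have := h (t + k); rewrite h' kt // => /(_ ke) /addrI.
  have -> : t + k - t = k by ring.
  by move/(scalerI (lt0r_neq0 k0)).
pose P t := affine v t /\ psi t = psi 0 + t *: v.
have : P 1.
  apply: (@locally_constant _ P 1) => //; last 2 first.
  - by split; [exists r|rewrite scale0r addr0].
  - by rewrite lexx ler01.
  move=> t /aff[u [_ ut]]; have [e e0 he] := loc _ _ ut.
  have [k k0 hk] := ut; have [m [m0 me mk]] := positive_below e0 k0.
  exists m => // s _ st; have us := he s (lt_le_trans st me).
  have ps := hk s (lt_le_trans st mk).
  split=> -[vs E].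
    have uv := uniq _ _ _ us vs; subst u.
    split=> //; apply: (addIr ((s - t) *: v)).
    by rewrite -ps E; plane_ring.
  have uv := uniq _ _ _ ut vs; subst u.
  by split=> //; rewrite ps E; plane_ring.
move=> [_]; rewrite /psi scale0r addr0 !scale1r => ->; apply/eq_edist.
have -> : phi x + v - phi x = v by plane_ring.
by have -> : x + w - x = w by plane_ring.
Qed.

(** The segment is a limit of parallel unfolded segments, which keep their length; by the Lipschitz
    bound their ends and the images of these converge. *)
Lemma unfolded_segment_limit x y w b : 0 < b ->
  (forall a t, 0 < a < b -> 0 <= t <= 1 -> U (x + a *: w + t *: (y - x))) ->
  edist (phi x) (phi y) = edist x y.
Proof.
move=> b0 h; apply/eqP; rewrite eq_le fold_lipschitz /= leNgt; apply/negP => lt.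
pose D := edist x y - edist (phi x) (phi y); have L0 := edist_ge0 w 0.
pose L := edist w 0 + 1; have D0 : 0 < D by rewrite /D; lra.
have L1 : 0 < L by rewrite /L; lra.
(* A shift by at most this multiple of [w] moves the two image points by at most [D / 2] in total,
   less than the supposed loss of length. *)
have DL : 0 < D / (4 * L) by rewrite divr_gt0 // mulr_gt0.
have [a [a0 ab2 aD]] := positive_below (divr_gt0 b0 (ltr0Sn R 1)) DL.
have ab : a < b by lra.
have shift z : edist (phi (z + a *: w)) (phi z) <= a * edist w 0.
  apply: le_trans (fold_lipschitz _ _) _.
  by have := edist_line z w a 0; rewrite scale0r addr0 subr0 gtr0_norm // => ->.
have := @unfolded_segment (x + a *: w) (y - x) (fun t => h a t ltac:(lra)).
have -> : x + a *: w + (y - x) = y + a *: w by plane_ring.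
have -> : edist (y + a *: w) (x + a *: w) = edist x y.
  by rewrite !edistE; congr Num.sqrt; dot_ring.
have := edist_triangle (phi y) (phi (y + a *: w)) (phi (x + a *: w)).
have := edist_triangle (phi x) (phi y) (phi (x + a *: w)).
rewrite (edistC (phi x) (phi (x + a *: w))) (edistC (phi y) (phi x)).
have := shift x; have := shift y.
move: aD D0; rewrite ler_pdivlMr ?mulr_gt0 // /D /L => aD D0.
by nra.
Qed.

(** Both bends take the same value on the axis, so the sets where [phi] follows one or the other
    cover a neighborhood as at a crease point. *)
Lemma bend_not_vertex p q c d z e : 0 < e -> d != 0 -> dot c c = dot d d ->
  cross d (z - p) = 0 ->
  (forall x, `|x - z| < e ->
     phi x = bend p q d c 1 x \/ phi x = bend p q d c (-1) x) ->
  ~ vertex_point phi z.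
Proof.
move=> e0 d0 cd dz h [nU nC _]; apply: nC; split=> //.
have iso s : s = 1 \/ s = -1 -> plane_isometry (bend p q d c s).
  by move=> s1; apply: bend_isometry => //; case: s1 => ->; ring.
pose A s := [set x | phi x = bend p q d c s x].
exists (A 1), (A (-1)), (bend p q d c 1), (bend p q d c (-1)); split.
- by apply/nbhs_plane; exists e.
- have [|E|E] := h z; first by rewrite subrr normr0.
    by rewrite /A /= E; split=> //; apply: bend_axis.
  by rewrite /A /= E; split=> //; apply: bend_axis.
- by split=> //; apply: iso; left.
- by split=> //; apply: iso; right.
move=> E; apply: (@bend_neq _ p q d c (p + perp d)) => //; last by rewrite E.
have -> : p + perp d - p = perp d by plane_ring.
have -> : cross d (perp d) = dot d d by dot_ring.
by rewrite dot_eq0.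
Qed.

Lemma bend_unfolded p q c d z e : 0 < e -> d != 0 -> dot c c = dot d d ->
  cross d (z - p) != 0 ->
  (forall x, `|x - z| < e ->
     phi x = bend p q d c 1 x \/ phi x = bend p q d c (-1) x) ->
  U z.
Proof.
move=> e0 d0 cd dz h; apply: (fold_agree_unfolded e0 _ _ h).
- by apply: bend_isometry => //; ring.
- by apply: bend_isometry => //; ring.
exact: bend_neq.
Qed.

End LocalFolding.

Section LocalStructure.
Variables (R : realType) (phi : plane R -> plane R).
Hypothesis Hphi : local_flat_folding phi.
Implicit Types (p q x y c d u v w : plane R) (a b e s t : R).

Local Notation U := (unfolded_point phi).

Lemma small_multiple u e : 0 < e ->
  exists2 k, 0 < k & forall t, `|t| <= k -> `|t *: u| < e.
Proof.
move=> e0; have [r r0 h] := line_near 0 u e0; exists (r / 2); first by rewrite divr_gt0.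
move=> t tr; have := h t 0; rewrite !add0r scale0r !subr0; apply.
by lra.
Qed.

(* The images of two opposite points of the boundary line are at maximal
   distance, so by the Lipschitz bound every other nearby point keeps its
   coordinate along this line, and at most two isometries remain. *)
Lemma half_disc_not_vertex g n e : n != 0 -> 0 < e ->
  (forall x, `|x - g| < e -> 0 < dot n (x - g) -> U x) -> ~ vertex_point phi g.
Proof.
move=> n0 e0 half; pose d := perp n; have nd : dot d d = dot n n by dot_ring.
have d0 : d != 0 by rewrite -dot_eq0 nd dot_eq0.
have [r r0 rad] := radial Hphi g.
have [m [m0 me mr]] := positive_below (divr_gt0 e0 (ltr0Sn R 1)) r0.
have [h h0 hd] := small_multiple d m0; have [b b0 bn] := small_multiple n m0.
have opp : edist (phi (g + h *: d)) (phi (g - h *: d)) =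
    edist (g + h *: d) (g - h *: d).
  apply: (@unfolded_segment_limit _ _ Hphi _ _ n b) => // a t a0 t0.
  have -> : g + h *: d + a *: n + t *: (g - h *: d - (g + h *: d)) =
    g + ((1 - 2 * t) * h *: d + a *: n) by plane_ring.
  apply: half.
    have -> v : g + v - g = v by plane_ring.
    apply: le_lt_trans (ler_normD _ _) _.
    have := bn a; rewrite ger0_norm; last lra.
    have := hd ((1 - 2 * t) * h); rewrite normrM (gtr0_norm h0).
    have : `|1 - 2 * t| <= 1 by rewrite ler_norml; lra.
    by move=> t1 H1 H2; have := H1 ltac:(nra); have := H2 ltac:(lra); lra.
  have -> : dot n (g + ((1 - 2 * t) * h *: d + a *: n) - g) = a * dot n n by dot_ring.
  by rewrite mulr_gt0 ?dot_gt0 //; lra.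
have nrad x : `|x - g| < r -> dot (phi x - phi g) (phi x - phi g) = dot (x - g) (x - g).
  by move=> /rad /eq_edist.
have hr s : `|s| <= h -> `|g + s *: d - g| < r.
  have -> : g + s *: d - g = s *: d by plane_ring.
  by move=> /hd; lra.
pose P := phi (g + h *: d) - phi g; pose M := phi (g - h *: d) - phi g.
have PP : dot P P = h ^+ 2 * dot d d.
  rewrite /P nrad; first by dot_ring.
  by apply: hr; rewrite gtr0_norm.
have MM : dot M M = h ^+ 2 * dot d d.
  have E : g - h *: d = g + (- h) *: d by plane_ring.
  rewrite /M E nrad; first by dot_ring.
  by apply: hr; rewrite normrN gtr0_norm.
have PM : dot (P - M) (P - M) = 4 * h ^+ 2 * dot d d.
  have -> : P - M = phi (g + h *: d) - phi (g - h *: d) by rewrite /P /M; plane_ring.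
  by move/eq_edist: opp => ->; dot_ring.
(* The parallelogram law: two vectors of equal length whose difference is twice as long are
   opposite. *)
have MP : M = - P.
  apply/eqP; rewrite -subr_eq0 opprK -dot_eq0.
  have : dot (M + P) (M + P) = 2 * dot P P + 2 * dot M M - dot (P - M) (P - M) by dot_ring.
  by rewrite PP MM PM => ->; apply/eqP; ring.
pose c := h^-1 *: P; have h0' := lt0r_neq0 h0.
have cc : dot c c = dot d d.
  transitivity (h^-1 ^+ 2 * dot P P); first by dot_ring.
  by rewrite PP; field.
apply: (@bend_not_vertex _ phi g (phi g) c d g r) => //.
  by rewrite subrr; dot_ring.
move=> x xr; apply: bend_cases => //; last exact: nrad.
(* The Lipschitz bounds towards the two ends of the diameter bound the coordinate along [P] from
   both sides. *)
have lip y : dot (phi x - phi y) (phi x - phi y) <= dot (x - y) (x - y).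
  by rewrite -le_edist; apply: fold_lipschitz.
have l1 := lip (g + h *: d); have l2 := lip (g - h *: d).
have E1 : phi x - phi (g + h *: d) = (phi x - phi g) - P by rewrite /P; plane_ring.
have E2 : phi x - phi (g - h *: d) = (phi x - phi g) + P.
  by rewrite -[P]opprK -MP /M; plane_ring.
rewrite E1 in l1; rewrite E2 in l2.
set y := phi x - phi g in l1 l2 *; set X := x - g.
have e1 : dot (y - P) (y - P) = dot y y + dot P P - 2 * dot P y by dot_ring.
have e2 : dot (y + P) (y + P) = dot y y + dot P P + 2 * dot P y by dot_ring.
have e3 : dot (x - (g + h *: d)) (x - (g + h *: d)) =
  dot X X + h ^+ 2 * dot d d - 2 * h * dot d X by rewrite /X; dot_ring.
have e4 : dot (x - (g - h *: d)) (x - (g - h *: d)) =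
  dot X X + h ^+ 2 * dot d d + 2 * h * dot d X by rewrite /X; dot_ring.
have yX : dot y y = dot X X by apply: nrad.
have : dot P y = h * dot d X by lra.
have -> : dot c y = h^-1 * dot P y by dot_ring.
by move=> ->; field.
Qed.

(** Where the two isometries differ, the choice between them is locally constant by
    [fold_agree_near], hence constant along the segment. *)
Lemma fold_agree_segment f1 f2 p e z w :
  plane_isometry f1 -> plane_isometry f2 ->
  (forall y, `|y - p| < e -> phi y = f1 y \/ phi y = f2 y) ->
  (forall t, 0 <= t <= 1 -> `|z + t *: w - p| < e /\ f1 (z + t *: w) <> f2 (z + t *: w)) ->
  phi z = f1 z -> phi (z + w) = f1 (z + w).
Proof.
move=> i1 i2 h seg z1; pose P t := phi (z + t *: w) = f1 (z + t *: w).
suff : P 1 by rewrite /P scale1r.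
apply: (@locally_constant _ P 1) => //; last 2 first.
- by rewrite /P scale0r addr0.
- by rewrite lexx ler01.
move=> t t0; have [te t12] := seg t t0.
pose r := e - `|z + t *: w - p|; have r0 : 0 < r by rewrite subr_gt0.
have hr y : `|y - (z + t *: w)| < r -> phi y = f1 y \/ phi y = f2 y.
  move=> yr; apply: h; have := ler_distD (z + t *: w) y p.
  by rewrite /r in yr; lra.
have [|E|E] := hr (z + t *: w); first by rewrite subrr normr0.
  have [k k0 hk] := fold_agree_near Hphi r0 i1 i2 hr E t12.
  have [b b0 hb] := line_near z w k0; exists b => // s _ st.
  by split=> // _; apply: hk; apply: hb.
have hr' y : `|y - (z + t *: w)| < r -> phi y = f2 y \/ phi y = f1 y.
  by move/hr => []; [right|left].
have [k k0 hk] := fold_agree_near Hphi r0 i2 i1 hr' E (nesym t12).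
have [b b0 hb] := line_near z w k0; exists b => // s s0 st.
have Es := hk _ (hb _ _ st); have [_ s12] := seg s s0.
by split; rewrite /P ?E ?Es => H; case: (t12); rewrite ?H //; case: s12.
Qed.

Lemma maps_agree_unfolded p e f : 0 < e -> plane_isometry f ->
  (forall x, `|x - p| < e -> phi x = f x) -> U p.
Proof.
move=> e0 isof h; exists [set y | `|y - p| < e]; split.
  by apply/nbhs_plane; exists e.
by move=> y z /= /h -> /h ->; apply: isof.
Qed.

Lemma convex_ball p e x y t : `|x - p| < e -> `|y - p| < e -> 0 <= t <= 1 ->
  `|x + t *: (y - x) - p| < e.
Proof.
move=> xe ye t0.
have -> : x + t *: (y - x) - p = (1 - t) *: (x - p) + t *: (y - p) by plane_ring.
apply: le_lt_trans (ler_normD _ _) _; rewrite !normrZ !ger0_norm; [|lra|lra].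
have [t1|t1] := ltP t 1; last first.
  have E : t = 1 by lra.
  by rewrite E; lra.
have : 0 < (1 - t) * (e - `|x - p|) by rewrite mulr_gt0 // subr_gt0.
have : 0 <= t * (e - `|y - p|) by rewrite mulr_ge0 //; lra.
by lra.
Qed.

Definition on_bends p q d c e := forall x, `|x - p| < e ->
  phi x = bend p q d c 1 x \/ phi x = bend p q d c (-1) x.

(** The half disc is convex and avoids the axis, so the bend used at one of its points [x0] is used
    throughout; [k] selects the side. *)
Lemma half_disc_bend p q d c e k : 0 < e -> d != 0 -> dot c c = dot d d ->
  on_bends p q d c e -> k = 1 \/ k = -1 ->
  exists s, (s = 1 \/ s = -1) /\
    forall x, `|x - p| < e -> 0 < k * cross d (x - p) -> phi x = bend p q d c s x.
Proof.
move=> e0 d0 cd h k1.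
have iso s : s = 1 \/ s = -1 -> plane_isometry (bend p q d c s).
  by move=> s1; apply: bend_isometry => //; case: s1 => ->; ring.
have [b b0 hb] := small_multiple (perp d) e0.
pose x0 := p + (k * b) *: perp d.
have x0e : `|x0 - p| < e.
  have -> : x0 - p = (k * b) *: perp d by rewrite /x0; plane_ring.
  by apply: hb; rewrite normrM (gtr0_norm b0); case: k1 => ->; rewrite ?normrN normr1 mul1r.
have x0k : 0 < k * cross d (x0 - p).
  have -> : k * cross d (x0 - p) = k ^+ 2 * (b * dot d d) by rewrite /x0; dot_ring.
  have -> : k ^+ 2 = 1 by case: k1 => ->; rewrite ?sqrrN expr1n.
  by rewrite mul1r mulr_gt0 ?dot_gt0.
have [s [s1 s0]] : exists s, (s = 1 \/ s = -1) /\ phi x0 = bend p q d c s x0.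
  by have [E|E] := h x0 x0e; [exists 1|exists (-1)]; split=> //; [left|right].
exists s; split=> // x xe xk.
have -> : x = x0 + (x - x0) by rewrite subrKC.
apply: (@fold_agree_segment _ (bend p q d c (- s)) p e) => //.
- exact: iso.
- by apply: iso; case: s1 => ->; [right|left; rewrite opprK].
- by move=> y /h; case: s1 => ->; rewrite ?opprK => -[]; by [left|right].
move=> t t0; split; first exact: convex_ball.
have nz : cross d (x0 + t *: (x - x0) - p) != 0.
  apply/eqP => E; have : k * cross d (x0 + t *: (x - x0) - p) =
    (1 - t) * (k * cross d (x0 - p)) + t * (k * cross d (x - p)) by dot_ring.
  by rewrite E mulr0; have [t1|t1] := ltP t (1/2); nra.
by have := @bend_neq _ p q d c _ d0 cd nz; case: s1 => ->; rewrite ?opprK => H1 H2; apply: H1.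
Qed.

(** The two half discs use opposite signs, as equal signs would make [p] unfolded. So points
    mirrored in the axis have the same image, and no point of the axis in the disc is unfolded. *)
Lemma bend_crease_line p d c e : 0 < e -> d != 0 -> dot c c = dot d d ->
  on_bends p (phi p) d c e -> ~ U p ->
  forall x, `|x - p| < e -> cross d (x - p) = 0 -> crease_point phi x.
Proof.
move=> e0 d0 cd h nUp x xe xd.
have sub z : `|z - x| < e - `|x - p| -> `|z - p| < e.
  by have := ler_distD x z p; lra.
pose r := e - `|x - p|; have r0 : 0 < r by rewrite subr_gt0.
suff nU : ~ U x.
  have [//|//|] := fold_cases Hphi x.
  have := @bend_not_vertex _ phi p (phi p) c d x r r0 d0 cd xd.
  by move=> H; have := H (fun z zx => h z (sub z zx)).
have [s [s1 hs]] := half_disc_bend e0 d0 cd h (or_introl erefl).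
have [s' [s1' hs']] := half_disc_bend e0 d0 cd h (or_intror erefl).
have opp : s' = - s.
  case: s1 s1' => E [] E'; subst; rewrite ?opprK //; case: nUp.
    apply: (maps_agree_unfolded e0 (bend_isometry p (phi p) d0 cd (expr1n _ 2))) => y ye.
    have [y0|y0|y0] := ltgtP (cross d (y - p)) 0.
    - by apply: hs' => //; lra.
    - by apply: hs => //; lra.
    by have [//|->] := h y ye; apply: bend_axis.
  apply: (maps_agree_unfolded e0 (@bend_isometry _ p (phi p) d c (-1) d0 cd _)) => [|y ye].
    by rewrite sqrrN expr1n.
  have [y0|y0|y0] := ltgtP (cross d (y - p)) 0.
  - by apply: hs' => //; lra.
  - by apply: hs => //; lra.
  by have [->|//] := h y ye; apply: bend_axis.
move=> /unfolded_box[b b0 hb].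
have [m [m0 mb mr]] := positive_below b0 r0.
have [k k0 hk] := small_multiple (perp d) m0.
pose y t := x + t *: perp d.
have yx t : `|t| <= k -> `|y t - x| < m.
  by move=> /hk; have -> : y t - x = t *: perp d by rewrite /y; plane_ring.
have k1 : `|k| <= k by rewrite gtr0_norm.
have k2 : `|- k| <= k by rewrite normrN gtr0_norm.
have dy t : cross d (y t - p) = t * dot d d.
  transitivity (cross d (x - p) + t * dot d d); first by rewrite /y; dot_ring.
  by rewrite xd add0r.
have N0 := dot_gt0 d0.
have E1 : phi (y k) = bend p (phi p) d c s (y k).
  apply: hs; last by rewrite dy mul1r mulr_gt0.
  by apply: sub; have := yx _ k1; rewrite /r in mr *; lra.
have E2 : phi (y (- k)) = bend p (phi p) d c s' (y (- k)).
  apply: hs'; last by rewrite dy; nra.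
  by apply: sub; have := yx _ k2; rewrite /r in mr *; lra.
have E : phi (y k) = phi (y (- k)).
  rewrite E1 E2 opp /bend !dy.
  have -> : dot d (y (- k) - p) = dot d (y k - p) by rewrite /y; dot_ring.
  by congr (_ + _ *: (_ + _ *: _)); ring.
have := hb (y k) (y (- k)) ltac:(have := yx _ k1; lra) ltac:(have := yx _ k2; lra).
rewrite E => /eq_edist; rewrite subrr.
have -> : dot (0 : plane R) 0 = 0 by dot_ring.
have -> : dot (y k - y (- k)) (y k - y (- k)) = 4 * k ^+ 2 * dot d d by rewrite /y; dot_ring.
have : 0 < k ^+ 2 * dot d d by rewrite mulr_gt0 // exprn_gt0.
by lra.
Qed.

(* Two isometries that agree only at [p] would make every other point near [p]
   unfolded, and since the punctured disc is connected only one of them would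
   be used. *)
Lemma crease_line p : crease_point phi p -> exists d e, [/\ d != 0, 0 < e &
  forall x, `|x - p| < e ->
    (cross d (x - p) != 0 -> U x) /\ (cross d (x - p) = 0 -> crease_point phi x)].
Proof.
move=> [nU [A1 [A2 [f1 [f2 [/nbhs_plane[e e0 eA] [A1p A2p] [i1 h1] [i2 h2] f12]]]]]].
have h y : `|y - p| < e -> phi y = f1 y \/ phi y = f2 y.
  by move=> /eA[/h1|/h2] ?; [left|right].
have [[d [d0 hd]]|no] := pselect (exists d, d != 0 /\ f1 (p + d) = f2 (p + d)).
  have [cd [s1 [hs1 E1]]] := isometry_bend p i1 d0.
  have [_ [s2 [hs2 E2]]] := isometry_bend p i2 d0.
  rewrite -(h1 p A1p) in cd E1; rewrite -(h2 p A2p) -hd in E2.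
  have s12 : s1 <> s2 by move=> E; apply: f12; apply/funext => x; rewrite E1 E2 E.
  exists d, e; split=> // x xe.
  have bends : on_bends p (phi p) d (f1 (p + d) - phi p) e.
    move=> y /h; rewrite E1 E2.
    by case: hs1 hs2 s12 => -> [] -> // _ []; by [left|right].
  split; last exact: bend_crease_line bends nU x xe.
  move=> xd; apply: (@bend_unfolded _ _ Hphi p (phi p) (f1 (p + d) - phi p) d x
    (e - `|x - p|)) => //.
    by rewrite subr_gt0.
  by move=> y yx; apply: bends; have := ler_distD x y p; lra.
have f12x x : x != p -> f1 x <> f2 x.
  by move=> xp E; apply: no; exists (x - p); rewrite subr_eq0 subrKC.
case: nU.
have [a a0 ha] := small_multiple (1, 0) e0.
have [b b0 hb] := small_multiple (0, 1) e0.
pose x0 := p + a *: (1, 0); pose x1 := p + b *: (0, 1).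
have x0e : `|x0 - p| < e.
  have -> : x0 - p = a *: (1, 0) by rewrite /x0; plane_ring.
  by apply: ha; rewrite gtr0_norm.
have x1e : `|x1 - p| < e.
  have -> : x1 - p = b *: (0, 1) by rewrite /x1; plane_ring.
  by apply: hb; rewrite gtr0_norm.
have one f f' : plane_isometry f -> plane_isometry f' ->
    (forall y, `|y - p| < e -> phi y = f y \/ phi y = f' y) ->
    (forall x, x != p -> f x <> f' x) -> phi p = f p -> phi x0 = f x0 -> U p.
  move=> isof isof' hf ne fp f0; apply: (maps_agree_unfolded e0 isof) => y ye.
  (* If [x], [z] and [p] are not collinear, the segment from [x] to [z] avoids [p], the only point
     where the isometries agree. *)
  have step x z : `|x - p| < e -> `|z - p| < e -> cross (x - p) (z - p) != 0 ->
      phi x = f x -> phi z = f z.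
    move=> xe ze xz E; have -> : z = x + (z - x) by rewrite subrKC.
    apply: (fold_agree_segment isof isof' hf) => // t t0.
    split; first exact: convex_ball.
    apply: ne; rewrite -subr_eq0; apply: contra xz => /eqP E0.
    have c1 : cross (x - p) (x + t *: (z - x) - p) = t * cross (x - p) (z - p) by dot_ring.
    have c2 : cross (x + t *: (z - x) - p) (z - p) = (1 - t) * cross (x - p) (z - p) by dot_ring.
    rewrite E0 in c1 c2.
    have z1 u : cross u 0 = 0 by dot_ring.
    have z2 u : cross 0 u = 0 by dot_ring.
    by rewrite z1 in c1; rewrite z2 in c2; apply/eqP; lra.
  have [/eqP y0|y0] := boolP (cross (x0 - p) (y - p) == 0); last exact: step f0.
  have [-> //|yp] := eqVneq y p.
  have x01 : cross (x0 - p) (x1 - p) != 0.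
    have -> : cross (x0 - p) (x1 - p) = a * b by rewrite /x0 /x1 /cross !planeE /=; ring.
    by rewrite lt0r_neq0 // mulr_gt0.
  (* A point [y] on the line through [p] and [x0] is reached by way of [x1], as the direct segment
     may contain [p]. *)
  apply: step (step _ _ x0e x1e x01 f0) => //.
  have c0 : cross (x0 - p) (y - p) = a * (y - p).2 by rewrite /x0 /cross !planeE /=; ring.
  have -> : cross (x1 - p) (y - p) = - (b * (y - p).1) by rewrite /x1 /cross !planeE /=; ring.
  rewrite oppr_eq0; apply: mulf_neq0; first exact: lt0r_neq0.
  apply: contra yp => /eqP y1; rewrite -subr_eq0; apply/eqP; apply: planeP => //.
  by move/eqP: y0; rewrite c0 mulf_eq0 (negPf (lt0r_neq0 a0)) => /eqP.
have [E|E] := h x0 x0e; first exact: (one f1 f2 i1 i2 h f12x (h1 p A1p)).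
apply: (one f2 f1 i2 i1 _ _ (h2 p A2p)) => //.
  by move=> y /h []; [right|left].
by move=> x /f12x /nesym.
Qed.

Lemma finite_radius (n : nat) (Q : 'I_n -> R -> Prop) :
  (forall i, exists2 e, 0 < e & Q i e) ->
  (forall i a b, 0 < a <= b -> Q i b -> Q i a) ->
  exists2 e, 0 < e & forall i, Q i e.
Proof.
move=> ex mono.
suff [e e0 he] : exists2 e, 0 < e & forall i, i \in enum 'I_n -> Q i e.
  by exists e => // i; apply: he; rewrite mem_enum.
elim: (enum 'I_n) => [|i l [e e0 he]]; first by exists 1.
have [b b0 hb] := ex i; have [m [m0 mb me]] := positive_below b0 e0.
exists m => // j; rewrite inE => /predU1P[->|/he hj].
  by apply: (mono _ _ b) hb; rewrite m0.
by apply: (mono _ _ e) hj; rewrite m0.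
Qed.

(* Isometries that agree with [phi] both at [p] and at [q] fix the line through
   [p] and [q], so only two of them are possible. *)
Lemma vertex_punctured p : vertex_point phi p -> exists2 e, 0 < e &
  forall q, q != p -> `|q - p| < e -> ~ vertex_point phi q /\
    exists2 r, 0 < r & forall x, `|x - q| < r -> cross (q - p) (x - q) != 0 -> U x.
Proof.
move=> [/(folded_maps Hphi)[n [f [e [e0 isof hf]]]] _ _]; exists e => // q qp qe.
pose d := q - p; have d0 : d != 0 by rewrite subr_eq0.
have qE : p + d = q by rewrite subrKC.
(* Within this radius of [q] only maps that agree with [phi] at [q] occur: the value of any other
   map stays too far from [phi q] for the Lipschitz bound. *)
have [i|i a b /andP[_ ab] hb x xa|r r0 hr] := @finite_radius n
  (fun i r => forall x, `|x - q| < r -> phi x = f i x -> f i q = phi q).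
- have [E|E] := pselect (f i q = phi q); first by exists 1.
  have D0 : 0 < edist (f i q) (phi q).
    rewrite lt_neqAle edist_ge0 andbT eq_sym; apply: contra_notN E => /eqP E.
    have /eqP := edist_sqr (f i q) (phi q); rewrite E expr0n /= eq_sym dot_eq0 subr_eq0.
    by move/eqP.
  exists (edist (f i q) (phi q) / 4); first by rewrite divr_gt0.
  move=> x xq xE; exfalso.
  have := edist_triangle (f i x) (f i q) (phi q).
  have [iso _] := isof i; rewrite (iso q x) // -{1}xE.
  have := fold_lipschitz Hphi x q; have := edist_le_norm x q; rewrite (edistC q x).
  lra.
- by apply: hb; apply: lt_le_trans ab.
pose c := phi q - phi p.
have e1 : 0 < e - `|q - p| by rewrite subr_gt0.
have [m [m0 mr me]] := positive_below r0 e1.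
have near x : `|x - q| < m -> dot c c = dot d d /\ exists s, (s = 1 \/ s = -1) /\
    phi x = bend p (phi p) d c s x.
  move=> xm; have [|i xi] := hf x; first by have := ler_distD q x p; lra.
  have iq := hr i x (lt_le_trans xm mr) xi; have [iso ip] := isof i.
  have [cd [s [s1 sE]]] := isometry_bend p iso d0.
  rewrite qE iq ip in cd sE; split=> //.
  by exists s; rewrite xi sE.
have cd : dot c c = dot d d by have [|//] := near q; rewrite subrr normr0.
have bends x : `|x - q| < m -> phi x = bend p (phi p) d c 1 x \/
    phi x = bend p (phi p) d c (-1) x.
  by move=> /near[_ [s [[->|->] sE]]]; [left|right].
split; first by apply: bend_not_vertex bends => //; dot_ring.
exists m => // x xm xd.
apply: (bend_unfolded Hphi (p := p) (q := phi p) (c := c) (d := d)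
  (e := m - `|x - q|)) => //.
- by rewrite subr_gt0.
- by have -> : cross d (x - p) = cross (q - p) (x - q) by rewrite /d; dot_ring.
by move=> y yx; apply: bends; have := ler_distD x y q; lra.
Qed.

End LocalStructure.

(** * Convexity of the faces *)

Section Convexity.
Variables (R : realType) (phi : plane R -> plane R).
Hypothesis Hphi : local_flat_folding phi.
Implicit Types (p q g x y z c d u v w : plane R) (a b e s t : R).

Local Notation U := (unfolded_point phi).

Lemma cross_small v e : 0 < e ->
  exists2 r, 0 < r & forall u, `|u| < r -> `|cross u v| < e.
Proof.
move=> e0; pose M := `|v.1| + `|v.2| + 1.
have M0 : 0 < M by rewrite ltr_pwDr // addr_ge0.
exists (e / M) => [|u]; first exact: divr_gt0.
rewrite ltr_pdivlMr // prod_normE /= => h; apply: le_lt_trans h.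
have h1 : `|u.1| <= Num.max `|u.1| `|u.2| by rewrite le_max lexx.
have h2 : `|u.2| <= Num.max `|u.1| `|u.2| by rewrite le_max lexx orbT.
apply: le_trans (ler_normB _ _) _; rewrite !normrM /M.
have := normr_ge0 v.1; have := normr_ge0 v.2; have := normr_ge0 u.1.
by nra.
Qed.

Lemma crease_folded x : crease_point phi x -> ~ U x.
Proof. by case. Qed.

(** As [g] is not a vertex point, it is a crease point. Its crease line is perpendicular to [n],
    since it would otherwise enter the unfolded half disc. *)
Lemma half_disc_line g n e : ~ U g -> n != 0 -> 0 < e ->
  (forall x, `|x - g| < e -> 0 < dot n (x - g) -> U x) ->
  crease_point phi g /\ exists2 r, 0 < r &
    forall x, `|x - g| < r -> dot n (x - g) = 0 -> crease_point phi x.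
Proof.
move=> nU n0 e0 half; have nV := half_disc_not_vertex Hphi n0 e0 half.
have Cg : crease_point phi g by have [] := fold_cases Hphi g.
split=> //; have [d [r [d0 r0 hd]]] := crease_line Hphi Cg.
have nd : dot n d = 0.
  apply/eqP/negPn/negP => nd.
  pose m := Num.min e r.
  have m0 : 0 < m by rewrite lt_min e0.
  have [k k0 hk] := small_multiple d m0.
  have [s sk sd] : exists2 s, `|s| <= k & 0 < s * dot n d.
    have [h|h] := ltP 0 (dot n d).
      by exists k; rewrite ?gtr0_norm // mulr_gt0.
    exists (- k); first by rewrite normrN gtr0_norm.
    by rewrite mulNr -mulrN mulr_gt0 // oppr_gt0 lt_neqAle nd.
  have E : g + s *: d - g = s *: d by plane_ring.
  have := hk s sk; rewrite -E lt_min => /andP[se sr].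
  have [_ hc] := hd _ sr.
  have /crease_folded := hc ltac:(rewrite E; dot_ring); apply.
  by apply: half => //; rewrite E; have -> : dot n (s *: d) = s * dot n d by dot_ring.
exists r => // x xr xn; have [_] := hd x xr; apply.
have := lagrange n d; rewrite nd expr0n add0r => h.
have : cross n d * cross d (x - g) = dot n d * dot d (x - g) - dot d d * dot n (x - g).
  by dot_ring.
rewrite nd xn mul0r mulr0 subrr => /eqP; rewrite mulf_eq0 => /orP[/eqP c0|/eqP //].
move/eqP: h; rewrite c0 expr0n eq_sym mulf_eq0.
by rewrite !dot_eq0 (negPf n0) (negPf d0).
Qed.

Definition visible z w := forall t, 0 <= t <= 1 -> U (z + t *: (w - z)).

(* Among the folded points of the triangle that are nearest to the apex [z],
   measured by [a + b], take the one nearest to the edge [z + v]: the points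
   below its level are unfolded, so it lies on a crease along this level. *)
Lemma triangle_unfolded z u v :
  (forall t, 0 <= t <= 1 -> U (z + t *: u)) ->
  (forall t, 0 <= t <= 1 -> U (z + t *: v)) ->
  forall a b, 0 <= a -> 0 <= b -> a + b <= 1 -> U (z + a *: u + b *: v).
Proof.
move=> Uu Uv a b a0 b0 ab.
(* When [u] and [v] are parallel, the point lies on one of the two given segments. *)
have [/eqP D0|D0] := boolP (cross u v == 0).
  have [->|u0] := eqVneq u 0; first by rewrite scaler0 addr0; apply: Uv; lra.
  have [k kv] := cross_eq0 u0 D0.
  have -> : z + a *: u + b *: v = z + (a + b * k) *: u by rewrite kv; plane_ring.
  have Uk t : 0 <= t <= 1 -> U (z + (t * k) *: u).
    by move=> /Uv; rewrite kv scalerA.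
  have [h|h] := ltP (a + b * k) 0.
    have k0 : k < 0 by nra.
    have -> : a + b * k = ((a + b * k) / k) * k by field; rewrite lt_eqF.
    apply: Uk; rewrite ler_ndivlMr // ler_ndivrMr // mul0r mul1r.
    by apply/andP; split; nra.
  have [h1|h1] := leP (a + b * k) 1; first by apply: Uu; lra.
  have k0 : 1 < k by nra.
  have -> : a + b * k = ((a + b * k) / k) * k by field; rewrite gt_eqF; lra.
  apply: Uk; rewrite ler_pdivlMr ?ler_pdivrMr ?mul0r ?mul1r; [|lra|lra].
  by apply/andP; split; nra.
apply: contrapT => nU.
pose g (p : R * R) := z + p.1 *: u + p.2 *: v.
pose K := (`[0, 1] `*` `[0, 1]) `&` [set p : R * R | p.1 + p.2 <= 1]
   `&` [set p | ~ U (g p)].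
have cg : continuous g.
  move=> p; apply: cvgD; first apply: cvgD; first exact: cvg_cst.
    by apply: cvgZr_tmp; exact: cvg_fst.
  by apply: cvgZr_tmp; exact: cvg_snd.
have csum : continuous (fun p : R * R => p.1 + p.2).
  by move=> p; apply: cvgD; [exact: cvg_fst|exact: cvg_snd].
have cK : compact K.
  apply: compact_closedI; first apply: compact_closedI.
  - by apply: compact_setX; apply: segment_compact.
  - apply: (@preimage_closed _ _ (fun p : R * R => p.1 + p.2) [set x | x <= 1]).
      by move=> p _; apply: csum.
    exact: closed_le.
  apply: (@preimage_closed _ _ g [set x | ~ U x]); first by move=> p _; apply: cg.
  rewrite -[X in closed X]/(~` [set x | U x]); apply: open_closedC.
  rewrite openE => x /(unfolded_open)[r r0 h].
  by apply/nbhs_plane; exists r.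
have KP p : K p <-> [/\ 0 <= p.1, 0 <= p.2, p.1 + p.2 <= 1 & ~ U (g p)].
  split=> [[[[/= p1 p2] p3] p4]|[p1 p2 p3 p4]].
    by move: p1 p2; rewrite !in_itv /= => /andP[? _] /andP[? _].
  by split=> //; split=> //; split; rewrite /= in_itv /=; apply/andP; split=> //; lra.
have [m /set_mem Km mmin] : exists2 m, m \in K & forall p, p \in K -> m.1 + m.2 <= p.1 + p.2.
  apply: (@compact_EVT_min _ _ (fun p : R * R => p.1 + p.2) K) => //.
    by exists (a, b); apply/KP.
  exact/continuous_subspaceT.
pose M := m.1 + m.2; pose K' := K `&` [set p : R * R | p.1 + p.2 <= M].
have [n /set_mem[Kn nM] nmin] : exists2 n, n \in K' & forall p, p \in K' -> - n.2 <= - p.2.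
  apply: (@compact_EVT_min _ _ (fun p : R * R => - p.2) K').
  - by exists m; split=> //=.
  - apply: compact_closedI => //.
    apply: (@preimage_closed _ _ (fun p : R * R => p.1 + p.2) [set x | x <= M]).
      by move=> p _; apply: csum.
    exact: closed_le.
  - apply: continuous_subspaceT => p.
    by apply: cvgN; exact: cvg_snd.
have nM' : n.1 + n.2 = M.
  by apply/eqP; rewrite eq_le nM /=; apply: mmin; rewrite inE.
have [n1 n2 n12 nG] := (KP n).1 Kn.
have [m1 m2 m12 mG] := (KP m).1 Km.
have n1' : 0 < n.1.
  rewrite lt_neqAle n1 andbT eq_sym; apply/negP => /eqP E; apply: nG.
  by rewrite /g E scale0r addr0; apply: Uv; lra.
have n2' : 0 < n.2.
  rewrite lt_neqAle n2 andbT eq_sym; apply/negP => /eqP E; apply: nG.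
  by rewrite /g E scale0r addr0; apply: Uu; lra.
(* [nu] is normal to the level lines of [a + b] and points to the lower levels. *)
pose D := cross u v; pose nu := D *: perp (v - u).
have nu0 : nu != 0.
  rewrite scaler_eq0 negb_or D0 /=; apply: contra D0 => /eqP E.
  have -> : cross u v = - dot (perp (v - u)) u by dot_ring.
  by rewrite E; apply/eqP; dot_ring.
(* Cramer's rule. *)
have coord x : x = g n + (cross (x - g n) v / D) *: u + (- cross (x - g n) u / D) *: v.
  apply: (scalerI D0); apply: planeP; rewrite /D /cross !planeE; field; exact: D0.
have D0' : 0 < `|D| by rewrite normr_gt0.
have [r1 r10 h1] := cross_small v (mulr_gt0 n1' D0').
have [r2 r20 h2] := cross_small u (mulr_gt0 n2' D0').
have [_ [r r0 hr]] : crease_point phi (g n) /\ exists2 r, 0 < r &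
    forall x, `|x - g n| < r -> dot nu (x - g n) = 0 -> crease_point phi x.
  apply: (@half_disc_line _ _ (Num.min r1 r2)) => //; first by rewrite lt_min r10.
  move=> x; rewrite lt_min => /andP[/h1 x1 /h2 x2] xn.
  set al := cross (x - g n) v / D; set be := - cross (x - g n) u / D.
  have al1 : `|al| < n.1 by rewrite normrM normfV ltr_pdivrMr.
  have be1 : `|be| < n.2 by rewrite normrM normrN normfV ltr_pdivrMr.
  move: al1 be1; rewrite !ltr_norml => /andP[al1 al2] /andP[be1 be2].
  have xE : x = g (n.1 + al, n.2 + be) by rewrite {1}(coord x) -/al -/be /g /=; plane_ring.
  have ab0 : al + be < 0.
    move: xn; have -> : dot nu (x - g n) = - (D ^+ 2 * (al + be)).
      rewrite {1}(coord x) -/al -/be /nu /D; move: (cross (x - g n) u) => ?.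
      by dot_ring.
    rewrite oppr_gt0 pmulr_rlt0 // exprn_even_gt0 //=.
  apply: contrapT => nUx.
  have /mmin : (n.1 + al, n.2 + be) \in K.
    rewrite inE; apply/KP; split=> /=; [| | |by rewrite -xE];
      by move: al1 be1 ab0 n12; clear; lra.
  by move: nM' ab0; rewrite /M /=; clear; lra.
(* A small move along the crease keeps the level but increases the second coordinate, which [n]
   maximizes. *)
have [k k0 hk] := small_multiple (v - u) r0.
have [l [l0 lk ln]] := positive_below k0 n1'.
have E : g (n.1 - l, n.2 + l) - g n = l *: (v - u) by rewrite /g /=; plane_ring.
have := hr (g (n.1 - l, n.2 + l)); rewrite E => /(_ (hk l _)).
have -> : dot nu (l *: (v - u)) = 0 by rewrite /nu; dot_ring.
rewrite gtr0_norm // => /(_ lk erefl) /crease_folded nUl.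
have /nmin : (n.1 - l, n.2 + l) \in K'.
  rewrite inE; split; [apply/KP; split|]; rewrite //=;
    by move: l0 ln n2 n12 nM'; clear; lra.
by rewrite /=; lra.
Qed.

Lemma visible_end z w : visible z w -> U w.
Proof. by move=> /(_ 1); rewrite scale1r subrKC; apply; rewrite lexx ler01. Qed.

Lemma visibleC z w : visible z w -> visible w z.
Proof.
move=> h t t0; have -> : w + t *: (z - w) = z + (1 - t) *: (w - z) by plane_ring.
by apply: h; lra.
Qed.

Lemma visible_combination z w w' a b : visible z w -> visible z w' ->
  0 <= a -> 0 <= b -> a + b <= 1 -> U (z + a *: (w - z) + b *: (w' - z)).
Proof. by move=> h h'; apply: triangle_unfolded. Qed.

(** The third side of a triangle with two unfolded sides is unfolded. This is the convexity of the
    faces. *)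
Lemma visible_trans z w w' : visible z w -> visible w w' -> visible z w'.
Proof.
move=> /visibleC h h' t t0.
have -> : z + t *: (w' - z) = w + (1 - t) *: (z - w) + t *: (w' - w) by plane_ring.
by apply: visible_combination => //; lra.
Qed.

Lemma visible_near z : U z -> exists2 r, 0 < r & forall w, `|w - z| < r -> visible z w.
Proof.
move=> /(unfolded_open)[r r0 h]; exists r => // w wr t t0; apply: h.
by apply: convex_ball => //; rewrite subrr normr0.
Qed.

Lemma visible_open z w : visible z w ->
  exists2 r, 0 < r & forall w', `|w' - w| < r -> visible z w'.
Proof.
move=> h; have [r r0 hr] := visible_near (visible_end h); exists r => // w' /hr.
exact: visible_trans.
Qed.

(** The point lies in a triangle with apex [z], one side along [e] and the other along the line. *)
Lemma unfolded_strip z d (e : plane R) :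
  (forall t, U (z + t *: d)) -> (forall t, 0 <= t < 1 -> U (z + t *: e)) ->
  forall a t, 0 <= a < 1 -> U (z + a *: e + t *: d).
Proof.
move=> Ud Ue a t a0; pose l := (1 + a) / 2; pose b := 1 - a / l.
have l0 : l != 0 by rewrite /l; apply: lt0r_neq0; lra.
have b0 : 0 < b.
  by rewrite /b subr_gt0 ltr_pdivrMr /l; lra.
have b0' := lt0r_neq0 b0.
have -> : z + a *: e + t *: d = z + (a / l) *: (l *: e) + b *: ((t / b) *: d).
  by rewrite !scalerA divfK // mulrCA mulfV // mulr1.
apply: triangle_unfolded.
- by move=> s s0; rewrite scalerA; apply: Ue; rewrite /l; nra.
- by move=> s s0; rewrite scalerA; apply: Ud.
- by rewrite divr_ge0 /l; lra.
- exact: ltW.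
by rewrite /b; lra.
Qed.

(** If a point of the boundary line were unfolded, the strip would extend beyond it and contain
    [z + e]. So the line is folded with an unfolded half disc at each point, and [half_disc_line]
    applies. *)
Lemma strip_boundary z d (e : plane R) : cross d e != 0 ->
  (forall t, U (z + t *: d)) -> (forall t, 0 <= t < 1 -> U (z + t *: e)) ->
  ~ U (z + e) -> forall t, crease_point phi (z + e + t *: d).
Proof.
move=> de Ud Ue nUe t.
have strip := unfolded_strip Ud Ue.
have nU : ~ U (z + e + t *: d).
  move=> /unfolded_open[r r0 h]; apply: nUe.
  have [k k0 hk] := small_multiple e r0.
  have Ud' s : U (z + t *: d + s *: d).
    by have -> : z + t *: d + s *: d = z + (t + s) *: d by plane_ring.
  have Ue' s : 0 <= s < 1 -> U (z + t *: d + s *: ((1 + k) *: e)).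
    move=> s0; have [s1|s1] := ltP (s * (1 + k)) 1.
      have -> : z + t *: d + s *: ((1 + k) *: e) = z + (s * (1 + k)) *: e + t *: d.
        by plane_ring.
      by apply: strip; rewrite s1 andbT mulr_ge0; lra.
    apply: h.
    have -> : z + t *: d + s *: ((1 + k) *: e) - (z + e + t *: d) = (s * (1 + k) - 1) *: e.
      by plane_ring.
    by apply: hk; rewrite ler_norml; nra.
  have k1 : 1 + k != 0 by apply: lt0r_neq0; lra.
  have := unfolded_strip Ud' Ue' (a := (1 + k)^-1) (- t).
  have -> : z + t *: d + (1 + k)^-1 *: ((1 + k) *: e) + - t *: d = z + e.
    by rewrite scalerA mulVf //; plane_ring.
  apply; rewrite invr_ge0 invf_lt1; lra.
(* The normal of the boundary line that points back into the strip. *)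
pose n := - cross d e *: perp d.
have d0 : d != 0 by apply: contra de => /eqP ->; apply/eqP; dot_ring.
have n0 : n != 0.
  rewrite scaler_eq0 negb_or oppr_eq0 de /= -dot_eq0.
  have -> : dot (perp d) (perp d) = dot d d by dot_ring.
  by rewrite dot_eq0.
have D0 : 0 < `|cross d e| by rewrite normr_gt0.
have [r r0 hr] := cross_small d D0.
have [] // := @half_disc_line (z + e + t *: d) n r nU n0 r0.
move=> x xr xn; pose al := - cross (x - (z + e + t *: d)) d / cross d e.
have /cross_eq0 : cross d (x - (z + e + t *: d) - al *: e) = 0.
  rewrite (_ : cross d _ = - cross (x - (z + e + t *: d)) d - al * cross d e).
    by rewrite /al divfK // subrr.
  by move: al => al; dot_ring.
move=> /(_ d0)[be bE].
have -> : x = z + (1 + al) *: e + (t + be) *: d.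
  have -> : x = z + e + t *: d + al *: e + (x - (z + e + t *: d) - al *: e) by plane_ring.
  by rewrite bE; plane_ring.
have al1 : `|al| < 1 by rewrite normrM normrN normfV ltr_pdivrMr // mul1r; apply: hr.
have al0 : al < 0.
  have E : x - (z + e + t *: d) = al *: e + be *: d.
    by rewrite -bE; plane_ring.
  move: xn; rewrite E; have -> : dot n (al *: e + be *: d) = - (cross d e ^+ 2 * al).
    by rewrite /n; dot_ring.
  by rewrite oppr_gt0 pmulr_rlt0 // exprn_even_gt0.
by apply: strip; move: al1; rewrite ltr_norml; lra.
Qed.

End Convexity.

(** * Lines of creases *)

Section CreaseLines.
Variables (R : realType) (phi : plane R -> plane R).
Hypothesis Hphi : local_flat_folding phi.
Implicit Types (p q g x y z c d u v w : plane R) (a b s t : R).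

Local Notation U := (unfolded_point phi).

Definition first_hit z d t :=
  [/\ 0 < t, ~ U (z + t *: d) & forall s, 0 <= s < t -> U (z + s *: d)].

Lemma first_hit_exists z d t : U z -> 0 < t -> ~ U (z + t *: d) ->
  exists2 s, s <= t & first_hit z d s.
Proof.
move=> Uz t0 nU.
have [s s0 hs|s /andP[s0 st] [nUs hs]] :=
  @first_point _ (fun s => ~ U (z + s *: d)) t (ltW t0) nU.
  move/contrapT/unfolded_open: hs => [r r0 h].
  have [e e0 he] := line_near z d r0.
  by exists e => // s' /he ss; apply; apply: h.
exists s => //; split=> //.
  rewrite lt_neqAle s0 andbT; apply/eqP => E; apply: nUs.
  by rewrite -E scale0r addr0.
by move=> s' /hs /contrapT.
Qed.

Lemma first_hit_unique z d s t : first_hit z d s -> first_hit z d t -> s = t.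
Proof.
move=> [s0 sU sh] [t0 tU th]; have [st|ts|//] := ltgtP s t.
  by case: sU; apply: th; rewrite st ltW.
by case: tU; apply: sh; rewrite ts ltW.
Qed.

(** The crease line at each point contains the nearby points of the given line, so it has the same
    direction. *)
Lemma crease_line_direction x d : d != 0 ->
  (forall t, crease_point phi (x + t *: d)) ->
  forall t, exists2 r, 0 < r &
    forall y, `|y - (x + t *: d)| < r -> cross d (y - (x + t *: d)) != 0 -> U y.
Proof.
move=> d0 line t; have [d' [r [d'0 r0 hr]]] := crease_line Hphi (line t).
exists r => // y /hr[hy _] dy; apply: hy; apply: contra dy => /eqP h.
have [k k0 hk] := small_multiple d r0.
have E : x + (t + k) *: d - (x + t *: d) = k *: d by plane_ring.
have dd' : cross d' d = 0.
  apply/eqP/negPn/negP => dd'.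
  have [|H _] := hr (x + (t + k) *: d).
    by rewrite E; apply: hk; rewrite gtr0_norm.
  case: (crease_folded (line (t + k))); apply: H; rewrite E.
  have -> : cross d' (k *: d) = k * cross d' d by dot_ring.
  by rewrite mulf_neq0 // lt0r_neq0.
have [a da] := cross_eq0 d'0 dd'.
have -> : cross d (y - (x + t *: d)) = a * cross d' (y - (x + t *: d)).
  by rewrite {1}da; dot_ring.
by rewrite h mulr0.
Qed.

(** Neighboring places along the line see each other just beside it, so visibility from [x + b *: u]
    propagates. The width [m] may depend on [l]. *)
Lemma crease_line_visible x d u b : cross d u != 0 -> 0 < b ->
  (forall t, crease_point phi (x + t *: d)) ->
  (forall t, 0 < t <= b -> U (x + t *: u)) ->
  forall l, 0 <= l -> exists2 m, 0 < m &
    forall s, 0 < s <= m -> visible phi (x + b *: u) (x + l *: d + s *: u).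
Proof.
move=> du b0 line side l l0.
have d0 : d != 0 by apply: contra du => /eqP ->; apply/eqP; dot_ring.
pose Q t := exists2 m, 0 < m &
    forall s, 0 < s <= m -> visible phi (x + b *: u) (x + t *: d + s *: u).
apply: (@locally_constant _ Q l l0) => //; last 2 first.
- exists b => // s s0 a a0; rewrite scale0r addr0.
  have -> : x + b *: u + a *: (x + s *: u - (x + b *: u)) = x + ((1 - a) * b + a * s) *: u.
    by plane_ring.
  apply: side; have : 0 <= a * (b - s) by rewrite mulr_ge0; lra.
  have [a1|a1] := ltP a 1; last first.
    have E : a = 1 by lra.
    by rewrite E; lra.
  have : 0 < (1 - a) * b by rewrite mulr_gt0; lra.
  have : 0 <= a * s by rewrite mulr_ge0; lra.
  by lra.
- by rewrite l0 lexx.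
move=> t _; have [r r0 hr] := crease_line_direction d0 line t.
have r20 : 0 < r / 2 by rewrite divr_gt0.
have [k1 k10 h1] := small_multiple d r20.
have [k2 k20 h2] := small_multiple u r20.
have near s s' m : `|s - t| < k1 -> `|s' - t| < k1 -> 0 < m <= k2 ->
    visible phi (x + s *: d + m *: u) (x + s' *: d + m *: u).
  move=> st s't m0 a a0.
  have E : x + s *: d + m *: u + a *: (x + s' *: d + m *: u - (x + s *: d + m *: u))
    - (x + t *: d) = ((1 - a) * (s - t) + a * (s' - t)) *: d + m *: u by plane_ring.
  apply: hr; rewrite E.
    apply: le_lt_trans (ler_normD _ _) _.
    have := h2 m ltac:(rewrite gtr0_norm; lra).
    suff : `|((1 - a) * (s - t) + a * (s' - t)) *: d| < r / 2 by lra.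
    apply: h1; move: st s't; rewrite !ltr_norml ler_norml => st s't.
    by apply/andP; split; nra.
  have -> : cross d (((1 - a) * (s - t) + a * (s' - t)) *: d + m *: u) = m * cross d u.
    by dot_ring.
  by rewrite mulf_neq0 // lt0r_neq0; lra.
have tr s s' : `|s - t| < k1 -> `|s' - t| < k1 -> Q s -> Q s'.
  move=> st s't [m m0 hm].
  have [n [n0 nm nk]] := positive_below m0 k20; exists n => // a a0.
  by apply: visible_trans (hm a _) (near s s' a _ _ _) => //; lra.
exists k1 => // s _ st; have tt : `|t - t| < k1 by rewrite subrr normr0.
by split; apply: tr.
Qed.

(** The widths from [crease_line_visible] have no common lower bound, but by convexity visible
    points close to the line give points at the fixed height [b / 2]. *)
Lemma crease_line_side x d u : cross d u != 0 ->
  (forall t, crease_point phi (x + t *: d)) ->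
  exists a, [/\ 0 < a, forall t, 0 < t <= a -> U (x + t *: u) &
    forall t, U (x + a *: u + t *: d)].
Proof.
move=> du line.
have d0 : d != 0 by apply: contra du => /eqP ->; apply/eqP; dot_ring.
have [r r0 hr] := crease_line_direction d0 line 0.
have [b b0 hb] := small_multiple u r0.
have side t : 0 < t <= b -> U (x + t *: u).
  move=> t0; have E : x + t *: u - (x + 0 *: d) = t *: u by plane_ring.
  apply: hr; rewrite E; first by apply: hb; rewrite gtr0_norm; lra.
  have -> : cross d (t *: u) = t * cross d u by dot_ring.
  by rewrite mulf_neq0 // lt0r_neq0; lra.
exists (b / 2); split; [by rewrite divr_gt0|by move=> t t0; apply: side; lra|].
suff far d' t : cross d' u != 0 -> (forall t, crease_point phi (x + t *: d')) ->
    0 <= t -> U (x + (b / 2) *: u + t *: d').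
  move=> t; have [t0|t0] := leP 0 t; first exact: far.
  have -> : x + (b / 2) *: u + t *: d = x + (b / 2) *: u + (- t) *: (- d) by plane_ring.
  apply: far; last lra.
    have -> : cross (- d) u = - cross d u by dot_ring.
    by rewrite oppr_eq0.
  move=> s; have -> : x + s *: - d = x + (- s) *: d by plane_ring.
  exact: line.
move=> {}du {}line t0.
have [m m0 hm] := crease_line_visible du b0 line side (mulr_ge0 (ler0n R 2) t0).
have [m' m'0 hm'] := crease_line_visible du b0 line side (lexx 0).
have [n [n0 nm nm']] := positive_below m0 m'0.
have [s [s0 sn sb]] := positive_below n0 (divr_gt0 b0 (ltr0Sn R 3)).
have sm := le_trans sn nm; have sm' := le_trans sn nm'.
(* With weights [1 / 2] and [q - 1 / 2] the heights [s] and the apex height [b] combine to [b / 2];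
   the distance [2 * t] makes up for the weight [1 / 2]. *)
pose q := b / (2 * (b - s)).
have bs : b - s != 0 by apply: lt0r_neq0; lra.
have q1 : 1 / 2 <= q by rewrite /q ler_pdivlMr ?mulr_gt0; lra.
have q2 : q <= 1 by rewrite /q ler_pdivrMr ?mulr_gt0; lra.
have -> : x + (b / 2) *: u + t *: d' = x + b *: u
   + (1 / 2) *: (x + (2 * t) *: d' + s *: u - (x + b *: u))
   + (q - 1 / 2) *: (x + 0 *: d' + s *: u - (x + b *: u)).
  by apply: planeP; rewrite /q !planeE; field.
by apply: (visible_combination Hphi (hm _ _) (hm' _ _)); lra.
Qed.

(* A line of creases bounds a parallel strip, whose other side is again a line
   of creases; moving towards [v], such lines cannot accumulate at a line
   other than a line of creases, and so would have to reach [v]. *)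
Lemma no_crease_line v x d : vertex_point phi v -> d != 0 ->
  ~ (forall t, crease_point phi (x + t *: d)).
Proof.
move=> Vv d0 line; have nCv : ~ crease_point phi v by case: Vv.
pose u := v - x.
have du : cross d u != 0.
  apply/eqP => /(cross_eq0 d0)[t tE]; apply: nCv.
  by have -> : v = x + t *: d by rewrite -tE subrKC.
pose P a := forall t, crease_point phi (x + a *: u + t *: d).
pose S := [set a | 0 <= a <= 1 /\ P a].
have S0 : S 0.
  by split=> [|t]; [rewrite lexx ler01|rewrite scale0r addr0].
have Sb : has_ubound S by exists 1 => a [/andP[]].
set s := sup S; have s0 : 0 <= s by exact: ub_le_sup.
have s1 : s <= 1 by apply: ge_sup; [exists 0|move=> a [/andP[]]].
have close e : 0 < e -> exists a, [/\ S a, a <= s & s - e < a].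
  move=> e0; have [a Sa ea] := @sup_adherent _ S e e0 (conj (ex_intro _ _ S0) Sb).
  by exists a; split=> //; exact: ub_le_sup.
(* Otherwise lines of creases accumulate at the line of [s]. Its points are then vertex points: an
   unfolded point has no creases nearby, and a crease point only those on one line. But vertex
   points are isolated. *)
have Ps : P s.
  apply: contrapT => nPs.
  have close' e : 0 < e -> exists a, [/\ P a, a < s & s - e < a].
    move=> /close[a [[_ Pa] as_ ea]]; exists a; split=> //.
    by rewrite lt_neqAle as_ andbT; apply: contra_notN nPs => /eqP <-.
  have Vs t : vertex_point phi (x + s *: u + t *: d).
    have [Ug|Cg|//] := fold_cases Hphi (x + s *: u + t *: d).
      have [r r0 hr] := unfolded_open Ug; have [k k0 hk] := small_multiple u r0.
      have [a [Pa sa ka]] := close' k k0; have := crease_folded (Pa t); case.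
      apply: hr.
      have -> : x + a *: u + t *: d - (x + s *: u + t *: d) = (a - s) *: u by plane_ring.
      by apply: hk; rewrite ler_norml; lra.
    have [d' [r [d'0 r0 hr]]] := crease_line Hphi Cg.
    have r20 : 0 < r / 2 by rewrite divr_gt0.
    have [k1 k10 h1] := small_multiple d r20.
    have [k2 k20 h2] := small_multiple u r20.
    have [a [Pa sa ka]] := close' k2 k20.
    have E b : x + a *: u + (t + b) *: d - (x + s *: u + t *: d) = (a - s) *: u + b *: d.
      by plane_ring.
    have on b : `|b| <= k1 -> (a - s) * cross d' u + b * cross d' d = 0.
      move=> bk; apply/eqP/negPn/negP => nz.
      have [] := hr (x + a *: u + (t + b) *: d).
        rewrite E; apply: le_lt_trans (ler_normD _ _) _.
        have := h1 b bk; have := h2 (a - s) ltac:(rewrite ler_norml; lra).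
        by lra.
      rewrite E.
      have -> : cross d' ((a - s) *: u + b *: d) = (a - s) * cross d' u + b * cross d' d.
        by dot_ring.
      by move=> /(_ nz) Ug _; case: (crease_folded (Pa (t + b))).
    have o1 := on 0 ltac:(rewrite normr0; exact: ltW).
    have o2 := on k1 ltac:(rewrite gtr0_norm //).
    have c1 : cross d' d = 0.
      have /eqP : k1 * cross d' d = 0 by lra.
      by rewrite mulf_eq0 (negPf (lt0r_neq0 k10)) => /eqP.
    have c2 : cross d' u = 0.
      have /eqP : (a - s) * cross d' u = 0 by lra.
      by rewrite mulf_eq0 subr_eq0 (lt_eqF sa) => /eqP.
    have [a1 E1] := cross_eq0 d'0 c1; have [a2 E2] := cross_eq0 d'0 c2.
    by case/eqP: du; rewrite E1 E2; dot_ring.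
  have [e e0 he] := vertex_punctured Hphi (Vs 0).
  have [k k0 hk] := small_multiple d e0.
  have E : x + s *: u + k *: d - (x + s *: u + 0 *: d) = k *: d by plane_ring.
  have [||nV _] := he (x + s *: u + k *: d) _ _; last exact: nV.
    by rewrite -subr_eq0 E scaler_eq0 negb_or lt0r_neq0.
  by rewrite E; apply: hk; rewrite gtr0_norm.
have [a [a0 aU side]] := crease_line_side du Ps.
have sa : s + a < 1.
  rewrite ltNge; apply/negP => sa; have [nUv _ _] := Vv; apply: nUv.
  have [s1'|s1'] := ltP s 1; last first.
    case: nCv; have E : s = 1 by lra.
    by have := Ps 0; rewrite E scale1r scale0r addr0 subrKC.
  have -> : v = x + s *: u + (1 - s) *: u by rewrite /u; plane_ring.
  by apply: aU; lra.
have vE : x + s *: u + a *: u + (1 - s - a) *: u = v by rewrite /u; plane_ring.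
(* The first folded point on the way to [v] lies on the other side of the strip, a line of creases
   beyond the supremum. *)
have [|||b b1 [b0 nUb bU]] := @first_hit_exists (x + s *: u + a *: u) u (1 - s - a).
- by have := side 0; rewrite scale0r addr0.
- by lra.
- by rewrite vE; case: Vv.
have : S (s + a + b).
  split=> [|t]; first lra.
  have -> : x + (s + a + b) *: u + t *: d = x + s *: u + a *: u + b *: u + t *: d.
    by plane_ring.
  apply: strip_boundary => //.
    have -> : cross d (b *: u) = b * cross d u by dot_ring.
    by rewrite mulf_neq0 // lt0r_neq0.
  move=> c c0; rewrite scalerA; apply: bU.
  by apply/andP; split; [rewrite mulr_ge0; lra|rewrite gtr_pMl; lra].
by move/(ub_le_sup Sb); rewrite -/s; lra.
Qed.

End CreaseLines.

(** * Connectedness of the folded points *)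

Section Connectivity.
Variables (R : realType) (phi : plane R -> plane R).
Hypothesis Hphi : local_flat_folding phi.
Implicit Types (p q g x y z c d u v w : plane R) (a b s t : R).

Local Notation U := (unfolded_point phi).

Variable A : plane R -> Prop.
Hypothesis A_locally_constant : forall g, ~ U g ->
  exists2 r, 0 < r & forall x, `|x - g| < r -> ~ U x -> (A x <-> A g).

(** A nearby ray hits no earlier, since visibility is an open condition, and not much later, since
    [z + t *: d] would then lie in an unfolded triangle. So it hits near the old point, where the
    label is the same. *)
Lemma first_hit_stable z d t : U z -> first_hit phi z d t ->
  exists2 r, 0 < r & forall d', `|d' - d| < r ->
    exists2 t', first_hit phi z d' t' & (A (z + t' *: d') <-> A (z + t *: d)).
Proof.
move=> Uz [t0 nU hU].
have [r r0 hr] := A_locally_constant nU.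
have r20 : 0 < r / 2 by rewrite divr_gt0.
have [k k0 hk] := small_multiple d r20.
have [b [b0 bk bt2]] := positive_below k0 (divr_gt0 t0 (ltr0Sn R 1)).
have bt : b < t by lra.
have vis : visible phi z (z + (t - b) *: d).
  move=> s s0; have -> : z + s *: (z + (t - b) *: d - z) = z + (s * (t - b)) *: d.
    by plane_ring.
  apply: hU; have : 0 <= s * (t - b) by rewrite mulr_ge0; lra.
  have : 0 <= (1 - s) * (t - b) by rewrite mulr_ge0; lra.
  by lra.
have [r1 r10 h1] := visible_open Hphi vis.
have [r2 r20' h2] := visible_near Uz.
pose M := t + b; pose N := M + M * t / b; have N0 : 0 < N.
  by rewrite /N addr_gt0 ?divr_gt0 ?mulr_gt0 /M //; lra.
have [n [n0 nr1 nr2]] := positive_below r10 r20'.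
have [m [m0 mr mn]] := positive_below r20 n0.
have mr1 := le_trans mn nr1; have mr2 := le_trans mn nr2.
exists (m / N) => [|d']; first exact: divr_gt0.
rewrite ltr_pdivlMr // => d'm.
have scaled s : 0 <= s <= N -> `|s *: (d' - d)| < m.
  move=> s0; apply: le_lt_trans d'm; rewrite normrZ ger0_norm; last lra.
  by rewrite mulrC ler_wpM2l //; lra.
have MN : 0 <= M <= N.
  have : 0 < M * t / b by rewrite divr_gt0 ?mulr_gt0 /M //; lra.
  by rewrite /N /M; lra.
have vis' : visible phi z (z + (t - b) *: d').
  apply: h1; have -> : z + (t - b) *: d' - (z + (t - b) *: d) = (t - b) *: (d' - d).
    by plane_ring.
  by apply: lt_le_trans mr1; apply: scaled; rewrite /M in MN; lra.
have M0 : 0 < M by exact: addr_gt0.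
have nvis : ~ visible phi z (z + M *: d').
  move=> vis2; apply: nU.
  (* Chosen so that [z + t *: d] has the weights [t / M] and [b / M] on [z + M *: d'] and [z']. *)
  pose z' := z + (M * t / b) *: (d - d').
  have vis3 : visible phi z z'.
    apply: h2; have -> : z' - z = - ((M * t / b) *: (d' - d)) by rewrite /z'; plane_ring.
    rewrite normrN; apply: lt_le_trans mr2; apply: scaled.
    have : 0 < M * t / b by apply: divr_gt0 => //; apply: mulr_gt0.
    by rewrite /N; move: M0; clear; lra.
  have M1 := lt0r_neq0 M0.
  have b1 := lt0r_neq0 b0.
  have -> : z + t *: d = z + (t / M) *: (z + M *: d' - z) + (b / M) *: (z' - z).
    by apply: planeP; rewrite /z' !planeE; field; rewrite M1 b1.
  apply: visible_combination => //.
  - by apply: divr_ge0; exact: ltW.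
  - by apply: divr_ge0; exact: ltW.
  by rewrite -mulrDl -/M mulfV.
have [s [s0 sU]] : exists s, 0 <= s <= 1 /\ ~ U (z + (s * M) *: d').
  apply: contrapT => no; apply: nvis => s s0; apply: contrapT => nUs; apply: no.
  by exists s; split=> //; move: nUs; rewrite addrAC subrr add0r scalerA.
have s1 : 0 < s.
  rewrite lt_neqAle; apply/andP; split; last lra.
  by apply/eqP => E; apply: sU; rewrite -E mul0r scale0r addr0.
have [t' t's hit] := first_hit_exists Uz (mulr_gt0 s1 M0) sU.
exists t' => //; have [t'0 t'U _] := hit.
have t'M : t' <= M.
  apply: le_trans t's _; rewrite ger_pMl //; lra.
have t'b : t - b < t'.
  rewrite ltNge; apply/negP => le; apply: t'U.
  have tb : t - b != 0 by apply: lt0r_neq0; lra.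
  have := vis' (t' / (t - b)); rewrite addrAC subrr add0r scalerA divfK //; apply.
  by rewrite divr_ge0 ?ler_pdivrMr; lra.
apply: hr => //.
have -> : z + t' *: d' - (z + t *: d) = t' *: (d' - d) + (t' - t) *: d by plane_ring.
apply: le_lt_trans (ler_normD _ _) _.
have := hk (t' - t) ltac:(rewrite ler_norml; rewrite /M in t'M; lra).
have := scaled t' ltac:(lra).
by lra.
Qed.

(** A parabolic arc from [- e] through [m] to [e], a polynomial substitute for a half turn. *)
Definition sweep (e m : plane R) s : plane R := s *: e + (1 - s ^+ 2) *: m.

Lemma sweep_near e m s r : 0 < r -> `|s| <= 1 -> exists2 k, 0 < k &
  forall s', `|s'| <= 1 -> `|s' - s| < k -> `|sweep e m s' - sweep e m s| < r.
Proof.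
move=> r0 s1; pose N := `|e| + 2 * `|m| + 1.
have N0 : 0 < N by rewrite /N ltr_pwDr // addr_ge0 // mulr_ge0.
exists (r / N) => [|s' s'1]; first exact: divr_gt0.
rewrite ltr_pdivlMr //; apply: le_lt_trans.
have -> : sweep e m s' - sweep e m s = (s' - s) *: (e - (s + s') *: m).
  by rewrite /sweep; plane_ring.
rewrite normrZ ler_wpM2l // /N; apply: le_trans (ler_normB _ _) _; rewrite normrZ.
have : `|s + s'| <= 2 by apply: le_trans (ler_normD _ _) _; lra.
have := normr_ge0 m => m0 /(ler_wpM2r m0); lra.
Qed.

(* If every ray of the sweep from [e] to [- e] hit the folded set, the label of
   the first hit would be constant along the sweep. *)
Lemma sweep_escape z (e m : plane R) : U z ->
  first_hit phi z e 1 -> first_hit phi z (- e) 1 -> A (z + e) -> ~ A (z - e) ->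
  exists2 s, -1 < s < 1 & forall t, 0 <= t -> U (z + t *: sweep e m s).
Proof.
move=> Uz hit1 hit2 A1 A2; apply: contrapT => no.
have swp1 : sweep e m 1 = e by rewrite /sweep; plane_ring.
have swpN1 : sweep e m (-1) = - e by rewrite /sweep; plane_ring.
have hit s : -1 <= s <= 1 -> exists t, first_hit phi z (sweep e m s) t.
  move=> s1; have [->|sN1] := eqVneq s (-1); first by exists 1; rewrite swpN1.
  have [->|s1'] := eqVneq s 1; first by exists 1; rewrite swp1.
  apply: contrapT => nohit; apply: no; exists s.
    by rewrite !lt_neqAle eq_sym sN1 s1'; lra.
  move=> t t0; apply: contrapT => nU; apply: nohit.
  have t1 : 0 < t.
    rewrite lt_neqAle t0 andbT; apply/eqP => E; apply: nU.
    by rewrite -E scale0r addr0.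
  by have [t' _ ?] := first_hit_exists Uz t1 nU; exists t'.
pose P a := exists2 t, first_hit phi z (sweep e m (1 - a)) t &
  A (z + t *: sweep e m (1 - a)).
have : P 2.
  apply: (@locally_constant _ P 2) => //; last 2 first.
  - by exists 1; rewrite subr0 swp1 ?scale1r.
  - by rewrite ler0n lexx.
  move=> a a0; have [|t ht] := hit (1 - a); first lra.
  have [r r0 hr] := first_hit_stable Uz ht.
  have [|k k0 hk] := @sweep_near e m (1 - a) r r0; first by rewrite ler_norml; lra.
  exists k => // b b0 ba.
  have [|t' ht' At'] := hr (sweep e m (1 - b)).
    apply: hk; first by rewrite ler_norml; lra.
    by rewrite (_ : _ - _ = a - b) 1?distrC //; ring.
  by split=> -[l hl Al]; [exists t => //; apply/At'|exists t' => //; apply/At'];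
    [rewrite (first_hit_unique ht' hl)|rewrite (first_hit_unique ht hl)].
move=> [t]; have -> : 1 - 2 = -1 :> R by ring.
rewrite swpN1 => ht; rewrite (first_hit_unique ht hit2) scale1r.
exact: A2.
Qed.

(* Two rays escaping on the two sides of the segment leave no room for [x] or
   [y] in their convex hull unless they are opposite; then they form an
   unfolded line, and a line of creases passes through [x]. *)
Lemma no_separated_pair o x y : vertex_point phi o -> ~ U x -> ~ U y ->
  (forall t, 0 < t < 1 -> U (x + t *: (y - x))) -> A x -> ~ A y -> False.
Proof.
move=> Vo nUx nUy seg Ax Ay.
pose z := (1 / 2) *: (x + y); pose e := (1 / 2) *: (x - y).
have xE : z + e = x by apply: planeP; rewrite /z /e !planeE; field.
have yE : z - e = y by apply: planeP; rewrite /z /e !planeE; field.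
have inU t : -1 < t < 1 -> U (z + t *: e).
  move=> t1; have -> : z + t *: e = x + ((1 - t) / 2) *: (y - x).
    by apply: planeP; rewrite /z /e !planeE; field.
  by apply: seg; lra.
have Uz : U z by have := inU 0; rewrite scale0r addr0; apply; lra.
have hit1 : first_hit phi z e 1.
  by split; rewrite ?ltr01 ?scale1r ?xE // => s s0; apply: inU; lra.
have hit2 : first_hit phi z (- e) 1.
  split; rewrite ?ltr01 ?scale1r ?yE // => s s0.
  have -> : s *: - e = (- s) *: e by plane_ring.
  by apply: inU; lra.
have e0 : e != 0.
  by apply/eqP => E; apply: nUx; rewrite -xE E addr0.
have Ae : A (z + e) by rewrite xE.
have Ane : ~ A (z - e) by rewrite yE.
have [s s1 hs] := sweep_escape (perp e) Uz hit1 hit2 Ae Ane.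
have [s' s'1 hs'] := sweep_escape (- perp e) Uz hit1 hit2 Ae Ane.
set d := sweep _ _ _ in hs; set d' := sweep _ _ _ in hs'.
pose a := 1 - s' ^+ 2; pose b := 1 - s ^+ 2.
have a0 : 0 < a by rewrite /a; nra.
have b0 : 0 < b by rewrite /b; nra.
(* The weights [a] and [b] cancel the components along [perp e], so the cone of the two rays
   contains [k *: e]. *)
pose k := a * s + b * s'.
have kE : a *: d + b *: d' = k *: e.
  by rewrite /d /d' /k /a /b /sweep; plane_ring.
have hull l : 0 < l -> U (z + l *: (k *: e)).
  move=> l0; rewrite -kE; pose T := l * (a + b).
  have ab : a + b != 0 by apply: lt0r_neq0; lra.
  have T0 : 0 <= T by apply: mulr_ge0; lra.
  have -> : z + l *: (a *: d + b *: d') =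
    z + (a / (a + b)) *: (T *: d) + (b / (a + b)) *: (T *: d').
    by apply: planeP; rewrite /T !planeE; field.
  apply: triangle_unfolded => //.
  - by move=> t t0; rewrite scalerA; apply: hs; apply: mulr_ge0; lra.
  - by move=> t t0; rewrite scalerA; apply: hs'; apply: mulr_ge0; lra.
  - by apply: divr_ge0; lra.
  - by apply: divr_ge0; lra.
  by rewrite -mulrDl mulfV.
(* A negative [k] makes [y] unfolded and a positive one [x]; for [k = 0] the rays are opposite. *)
have [k0|k0|k0] := ltgtP k 0.
- apply: nUy; rewrite -yE; have := hull (- k^-1); rewrite oppr_gt0 invr_lt0.
  by move=> /(_ k0); rewrite scalerA mulNr mulVf ?lt_eqF // scaleN1r.
- apply: nUx; rewrite -xE; have := hull k^-1; rewrite invr_gt0.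
  by move=> /(_ k0); rewrite scalerA mulVf ?gt_eqF // scale1r.
have dE : d' = - (a / b) *: d.
  have b1 := lt0r_neq0 b0; apply: (scalerI b1).
  have -> : b *: (- (a / b) *: d) = - (a *: d) by apply: planeP; rewrite !planeE; field.
  by apply/eqP; rewrite -subr_eq0 opprK addrC kE k0 scale0r.
have Ud t : U (z + t *: d).
  have [t0|t0] := leP 0 t; first exact: hs.
  have -> : t *: d = (- t * (b / a)) *: d'.
    have a1 := lt0r_neq0 a0; have b1 := lt0r_neq0 b0.
    by rewrite dE; apply: planeP; rewrite !planeE; field; rewrite a1 b1.
  by apply: hs'; apply: mulr_ge0; [lra|apply: divr_ge0; lra].
have de : cross d e != 0.
  have -> : cross d e = - (b * dot e e) by rewrite /d /b /sweep; dot_ring.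
  by rewrite oppr_eq0; apply: mulf_neq0; [exact: lt0r_neq0|rewrite dot_eq0].
have d0 : d != 0 by apply: contra de => /eqP ->; apply/eqP; dot_ring.
apply: (no_crease_line Hphi (x := x) Vo d0) => t; rewrite -xE.
apply: strip_boundary => //; first by move=> c c0; apply: inU; lra.
by rewrite xE.
Qed.

(** On the way from [x] to [y], take the first folded point outside [A] and then, going back, the
    first folded point in [A]. No folded point lies between them. *)
Lemma folded_label_constant o x y : vertex_point phi o ->
  ~ U x -> ~ U y -> A x -> A y.
Proof.
move=> Vo nUx nUy Ax; apply: contrapT => nAy.
pose g t := x + t *: (y - x).
have opn P : (forall t, ~ U (g t) -> exists2 r, 0 < r &
      forall s, `|g s - g t| < r -> ~ U (g s) -> P t -> P s) ->
    forall t, ~ (~ U (g t) /\ ~ P t) ->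
    exists2 k, 0 < k & forall s, `|s - t| < k -> ~ (~ U (g s) /\ ~ P s).
  move=> loc t nP; have [Ug|nUg] := pselect (U (g t)).
    have [r r0 hr] := unfolded_open Ug; have [k k0 hk] := line_near x (y - x) r0.
    by exists k => // s /hk/hr ? [].
  have [r r0 hr] := loc t nUg; have [k k0 hk] := line_near x (y - x) r0.
  exists k => // s /hk st [nUs nPs]; apply: nPs; apply: hr st nUs _.
  by apply: contrapT => nPt; apply: nP.
have [t t0 [[nUt nAt] ht]] : exists2 t, 0 <= t <= 1 &
    (~ U (g t) /\ ~ A (g t)) /\ forall s, 0 <= s < t -> ~ (~ U (g s) /\ ~ A (g s)).
  apply: (@first_point _ (fun t => ~ U (g t) /\ ~ A (g t)) 1) => //.
    by rewrite /g scale1r subrKC.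
  move=> t _; apply: (opn (fun t => A (g t))) => {}t /A_locally_constant[r r0 hr].
  by exists r => // s /hr h nU At; apply/h.
have [s s0 [[nUs nAs] hs]] : exists2 s, 0 <= s <= t &
    (~ U (g (t - s)) /\ A (g (t - s))) /\
    forall a, 0 <= a < s -> ~ (~ U (g (t - a)) /\ A (g (t - a))).
  apply: (@first_point _ (fun s => ~ U (g (t - s)) /\ A (g (t - s))) t).
  - by case/andP: t0.
  - by rewrite subrr /g scale0r addr0.
  move=> a _ nP.
  have [|[] |k k0 hk] := opn (fun t => ~ A (g t)) _ (t - a).
  - move=> l /A_locally_constant[r r0 hr].
    by exists r => // s /hr h nU nAl As; apply: nAl; exact: (h nU).1.
  - by move=> nU /contrapT At; apply: nP.
  exists k => // b ba [nU Ab]; apply: (hk (t - b)); last by split=> // /(_ Ab).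
  by rewrite (_ : _ - _ = a - b) 1?distrC //; ring.
have s1 : 0 < s.
  rewrite lt_neqAle; apply/andP; split; last lra.
  by apply/eqP => E; apply: nAt; move: nAs; rewrite -E subr0.
apply: (@no_separated_pair o (g (t - s)) (g t) Vo) => // a a0.
have -> : g (t - s) + a *: (g t - g (t - s)) = g (t - (1 - a) * s).
  by rewrite /g; plane_ring.
apply: contrapT => nU.
have [Ag|nAg] := pselect (A (g (t - (1 - a) * s))).
  by apply: (hs ((1 - a) * s)) => //; rewrite mulr_ge0 ?gtr_pMl; lra.
apply: (ht (t - (1 - a) * s)) => //.
have : (1 - a) * s <= s by rewrite ger_pMl; lra.
have : 0 < (1 - a) * s by rewrite mulr_gt0; lra.
lra.
Qed.

End Connectivity.

(** * From folded points to vertex points *)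

Section Attachment.
Variables (R : realType) (phi : plane R -> plane R).
Hypothesis Hphi : local_flat_folding phi.
Implicit Types (p q g x y z c d u v w : plane R) (a b s t : R).

Local Notation U := (unfolded_point phi).
Local Notation crease := (crease_point phi).
Local Notation vertex := (vertex_point phi).

Lemma vertex_not_crease p : vertex p -> ~ crease p.
Proof. by case. Qed.

(** Folded points close to [g] lie on its crease line, so accumulation along [d] makes [d] parallel
    to it. *)
Lemma crease_extends g d :
  (forall e, 0 < e -> exists t, [/\ t != 0, `|t| < e & ~ U (g + t *: d)]) ->
  crease g -> exists2 r, 0 < r & forall t, `|t| < r -> crease (g + t *: d).
Proof.
move=> acc /(crease_line Hphi)[d' [r [d'0 r0 hr]]].
have [k k0 hk] := small_multiple d r0.
have E t : g + t *: d - g = t *: d by plane_ring.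
have cE t : cross d' (t *: d) = t * cross d' d by dot_ring.
have d'd : cross d' d = 0.
  have [t [t0 tk nU]] := acc k k0; apply/eqP/negPn/negP => nz; apply: nU.
  have [H _] := hr (g + t *: d) ltac:(rewrite E; apply: hk; exact: ltW).
  by apply: H; rewrite E cE; apply: mulf_neq0.
exists k => // t /ltW/hk tr.
have [_ H] := hr (g + t *: d) ltac:(by rewrite E).
by apply: H; rewrite E cE d'd mulr0.
Qed.

(** A limit of crease points is not unfolded, and at a crease point the creases continue on the same
    line, so only a vertex point can stop them. *)
Lemma crease_ray_end g d r : 0 < r -> (forall t, 0 <= t < r -> crease (g + t *: d)) ->
  (forall t, 0 <= t -> crease (g + t *: d)) \/
  exists t, [/\ 0 < t, vertex (g + t *: d) & forall s, 0 <= s < t -> crease (g + s *: d)].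
Proof.
move=> r0 start.
have [[t ht]|no] := pselect (exists t, [/\ 0 < t, vertex (g + t *: d) &
  forall s, 0 <= s < t -> crease (g + s *: d)]); first by right; exists t.
left=> b b0; apply: (@real_induction _ (fun t => crease (g + t *: d)) b) => //;
  last by rewrite b0 lexx.
- by apply: start; rewrite lexx.
- move=> t t0 ht; have [E|t1] := eqVneq t 0.
    by exists r => // s st _; apply: start; lra.
  have tp : 0 < t by rewrite lt_neqAle eq_sym t1; case/andP: t0.
  have Ct : crease (g + t *: d) by apply: ht; lra.
  have [|k k0 hk] := @crease_extends (g + t *: d) d _ Ct; last first.
    exists k => // s st sb; have := hk (s - t).
    have -> : g + t *: d + (s - t) *: d = g + s *: d by plane_ring.
    by apply; rewrite ltr_norml; lra.
  move=> e e0; have [m [m0 me2 mt]] := positive_below (divr_gt0 e0 (ltr0Sn R 1)) tp.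
  have me : m < e by lra.
  exists (- m); split; [by rewrite oppr_eq0 lt0r_neq0|by rewrite normrN gtr0_norm|].
  have -> : g + t *: d + - m *: d = g + (t - m) *: d by plane_ring.
  by apply: crease_folded; apply: ht; lra.
move=> t t0 ht; have [Ut|//|Vt] := fold_cases Hphi (g + t *: d).
  have [e e0 he] := unfolded_open Ut; have [k k0 hk] := line_near g d e0.
  have [|s [s0 ts st]] := @nonneg_left_of _ t k _ k0; first by case/andP: t0.
  case: (crease_folded (ht s _)); first by rewrite s0.
  by apply: he; apply: hk; rewrite ltr_norml; lra.
by case: no; exists t; split=> //; case/andP: t0.
Qed.

(** These are the vertices at the ends of the edge, finite or infinite, that carries [g]; a vertex
    point is attached to itself alone. *)
Definition attached g u := vertex u /\
  (u = g \/ crease g /\ open_segment u g `<=` [set x | crease x]).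

Lemma attached_vertex g u : vertex g -> attached g u -> u = g.
Proof. by move=> /vertex_not_crease nC [_ [//|[/nC]]]. Qed.

Lemma attached_crease g u : crease g -> attached g u ->
  vertex u /\ forall t, 0 <= t < 1 -> crease (g + t *: (u - g)).
Proof.
move=> Cg [Vu [E|[_ seg]]]; first by case: (vertex_not_crease Vu); rewrite E.
split=> // t t1; have [->|t0] := eqVneq t 0; first by rewrite scale0r addr0.
apply: seg; exists (1 - t); split; last by plane_ring.
- by lra.
- by rewrite ltrBlDr ltrDl lt_neqAle eq_sym t0; case/andP: t1.
Qed.

Lemma crease_attached g d t : 0 < t -> vertex (g + t *: d) ->
  (forall s, 0 <= s < t -> crease (g + s *: d)) -> attached g (g + t *: d).
Proof.
move=> t0 Vt Cs; split=> //; right; split.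
  by have := Cs 0; rewrite scale0r addr0; apply; rewrite lexx.
move=> _ [a [a0 a1 ->]] /=.
have -> : g + t *: d + a *: (g - (g + t *: d)) = g + ((1 - a) * t) *: d by plane_ring.
by apply: Cs; apply/andP; split; [apply: mulr_ge0; lra|rewrite gtr_pMl; lra].
Qed.

Lemma crease_segments_collinear g x y :
  crease g -> x != g -> y != g ->
  (forall t, 0 <= t < 1 -> crease (g + t *: (x - g))) ->
  (forall t, 0 <= t < 1 -> crease (g + t *: (y - g))) ->
  exists2 s, s != 0 & x = g + s *: (y - g).
Proof.
move=> Cg xg yg hx hy; have [d [r [d0 r0 hr]]] := crease_line Hphi Cg.
have dir w : w != g -> (forall t, 0 <= t < 1 -> crease (g + t *: (w - g))) ->
    exists2 a, a != 0 & w - g = a *: d.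
  move=> wg hw; have [k k0 hk] := small_multiple (w - g) r0.
  have [m [m0 mk m2]] := positive_below k0 (divr_gt0 ltr01 (ltr0Sn R 1)).
  have m1 : m < 1 by lra.
  have E : g + m *: (w - g) - g = m *: (w - g) by plane_ring.
  have [H _] := hr (g + m *: (w - g)) ltac:(rewrite E; apply: hk; rewrite gtr0_norm //).
  have /eqP : cross d (m *: (w - g)) = 0.
    apply/eqP/negPn/negP => nz; apply: (crease_folded (hw m _)); first lra.
    by apply: H; rewrite E.
  have -> : cross d (m *: (w - g)) = m * cross d (w - g) by dot_ring.
  rewrite mulf_eq0 (negPf (lt0r_neq0 m0)) => /eqP /(cross_eq0 d0)[a aE].
  exists a => //; apply: contra wg => /eqP a0.
  by rewrite -subr_eq0 aE a0 scale0r.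
have [a a0 aE] := dir x xg hx; have [b b0 bE] := dir y yg hy.
exists (a / b); first by rewrite mulf_neq0 // invr_eq0.
by rewrite bE scalerA divfK // -aE subrKC.
Qed.

(** As [u] is no crease point, [x] lies on the line through [g] and [u] on the near side of [u]. The
    segment from [u] to [x] is covered by those from [g] to [u] and to [x]. *)
Lemma attached_move g x u : crease g -> attached g u ->
  (forall t, 0 <= t <= 1 -> crease (g + t *: (x - g))) -> attached x u.
Proof.
move=> Cg gu hx; have [Vu hu] := attached_crease Cg gu.
have nCu := vertex_not_crease Vu.
have [-> //|xg] := eqVneq x g.
have ug : u != g by apply: contra_notN nCu => /eqP ->.
have [|s s0 xE] := crease_segments_collinear Cg xg ug _ hu.
  by move=> t t0; apply: hx; lra.
have gE : u = g + s^-1 *: (x - g).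
  by rewrite xE addrAC subrr add0r scalerA mulVf // scale1r subrKC.
have s1 : s < 1.
  rewrite ltNge; apply/negP => s1; apply: nCu; rewrite gE; apply: hx.
  by rewrite invr_ge0 invf_le1; lra.
split=> //; right; split.
  by have := hx 1; rewrite scale1r subrKC; apply; rewrite ler01 lexx.
move=> _ [t [t0 t1 ->]] /=; pose r := 1 - t * (1 - s).
have -> : u + t *: (x - u) = g + r *: (u - g) by rewrite /r xE; plane_ring.
have r1 : r < 1 by have : 0 < t * (1 - s) by [apply: mulr_gt0; lra|]; rewrite /r; lra.
have [r0|r0] := leP 0 r; first by apply: hu; rewrite r0.
have sr : s < r.
  by have : 0 < (1 - t) * (1 - s) by [apply: mulr_gt0; lra|]; rewrite /r; lra.
have -> : g + r *: (u - g) = g + (r / s) *: (x - g).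
  by rewrite {1}gE addrAC subrr add0r scalerA.
by apply: hx; rewrite ler_ndivlMr ?ler_ndivrMr; lra.
Qed.

(** Both vertices lie on the crease line at [g]. On the same side they coincide, as neither precedes
    the other; on opposite sides [g] lies inside an edge between them. *)
Lemma attached_unique g u w : crease g -> attached g u -> attached g w ->
  u = w \/ segment_edge phi (open_segment u w) u w.
Proof.
move=> Cg /(attached_crease Cg)[Vu hu] /(attached_crease Cg)[Vw hw].
have nCu := vertex_not_crease Vu; have nCw := vertex_not_crease Vw.
have ug : u != g by apply: contra_notN nCu => /eqP ->.
have wg : w != g by apply: contra_notN nCw => /eqP ->.
have [s s0 uE] := crease_segments_collinear Cg ug wg hu hw.
have wE : w = g + s^-1 *: (u - g).
  by rewrite uE addrAC subrr add0r scalerA mulVf // scale1r subrKC.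
have [sp|sn|E] := ltgtP 0 s; last by rewrite E eqxx in s0.
  left; have [s1|s1|E] := ltgtP s 1.
  - by case: nCu; rewrite uE; apply: hw; rewrite s1 ltW.
  - by case: nCw; rewrite wE; apply: hu; rewrite invr_ge0 ltW // invf_lt1.
  by rewrite uE E scale1r subrKC.
right; split=> //.
  move=> E; have : (1 - s) *: (w - g) = 0.
    by rewrite scalerBl scale1r; apply/eqP; rewrite subr_eq0 -{1}E uE addrAC subrr add0r.
  by move/eqP; rewrite scaler_eq0 !subr_eq0 (negPf wg) orbF => /eqP; lra.
move=> _ [t [t0 t1 ->]] /=.
have [r0|r0] := leP 0 (s + t * (1 - s)).
  have -> : u + t *: (w - u) = g + (s + t * (1 - s)) *: (w - g) by rewrite uE; plane_ring.
  apply: hw; rewrite r0.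
  have : 0 < (1 - t) * (1 - s) by apply: mulr_gt0; lra.
  by lra.
have -> : u + t *: (w - u) = g + ((s + t * (1 - s)) / s) *: (u - g).
  by rewrite wE; apply: planeP; rewrite !planeE; field.
apply: hu; rewrite ler_ndivlMr // ltr_ndivrMr //.
have : 0 < t * (1 - s) by apply: mulr_gt0; lra.
by lra.
Qed.

(** Off the line through [g] the points near [x] are unfolded, so the crease at [x] points to [g].
    Followed that way it meets no other vertex point and cannot pass [g]. *)
Lemma near_vertex_attached g : vertex g -> exists2 r, 0 < r &
  forall x, x != g -> `|x - g| < r -> ~ U x -> crease x /\ attached x g.
Proof.
move=> Vg; have [r r0 hr] := vertex_punctured Hphi Vg; exists r => // x xg xr nUx.
have [nVx [k k0 hk]] := hr x xg xr.
have Cx : crease x by have [] := fold_cases Hphi x.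
split=> //; pose d := g - x.
have [d' [r' [d'0 r'0 hr']]] := crease_line Hphi Cx.
have [b b0 hb] := small_multiple d' r'0; have [c c0 hc] := small_multiple d' k0.
have d'd : cross (x - g) d' = 0.
  have [m [m0 mb mc]] := positive_below b0 c0.
  have E : x + m *: d' - x = m *: d' by plane_ring.
  have [_ H] := hr' (x + m *: d') ltac:(rewrite E; apply: hb; rewrite gtr0_norm //).
  apply/eqP/negPn/negP => nz.
  case: (crease_folded (H ltac:(rewrite E; dot_ring))); apply: hk; rewrite E.
    by apply: hc; rewrite gtr0_norm.
  have -> : cross (x - g) (m *: d') = m * cross (x - g) d' by dot_ring.
  by apply: mulf_neq0 => //; exact: lt0r_neq0.
have [s s0 hs] : exists2 s, 0 < s & forall t, 0 <= t < s -> crease (x + t *: d).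
  have [s s0 hs] := small_multiple d r'0; exists s => // t ts.
  have E : x + t *: d - x = t *: d by plane_ring.
  have [_ H] := hr' (x + t *: d) ltac:(rewrite E; apply: hs; rewrite ger0_norm; lra).
  apply: H; rewrite E.
  transitivity (t * cross (x - g) d'); first by rewrite /d; dot_ring.
  by rewrite d'd mulr0.
have nCg := vertex_not_crease Vg.
have gE : x + 1 *: d = g by rewrite scale1r subrKC.
have [ray|[t [t0 Vt Ct]]] := crease_ray_end s0 hs.
  by case: nCg; rewrite -gE; apply: ray.
have [t1|t1|E] := ltgtP t 1; last by rewrite -gE -E; apply: crease_attached.
- have E : x + t *: d - g = (1 - t) *: (x - g) by rewrite /d; plane_ring.
  have [||nV _] := hr (x + t *: d) _ _; last by case: nV.
    by rewrite -subr_eq0 E scaler_eq0 !subr_eq0 (negPf xg) orbF eq_sym lt_eqF.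
  rewrite E normrZ ger0_norm; last lra.
  by apply: le_lt_trans xr; rewrite ger_pMl ?normr_gt0 ?subr_eq0 //; lra.
by case: nCg; rewrite -gE; apply: Ct; rewrite ler01.
Qed.

(** Along a crease the attached vertices stay the same. Folded points near a vertex point [g] are
    attached to [g], and any other vertex attached to them is joined to [g] by an edge, along which
    [C] is closed. *)
Lemma attached_locally_constant (C : plane R -> Prop) :
  (forall e u w, segment_edge phi e u w -> C u -> C w) ->
  forall g, ~ U g -> exists2 r, 0 < r & forall x, `|x - g| < r -> ~ U x ->
    ((exists2 u, C u & attached x u) <-> (exists2 u, C u & attached g u)).
Proof.
move=> edge g nUg; have [//|Cg|Vg] := fold_cases Hphi g.
  have [d [r [d0 r0 hr]]] := crease_line Hphi Cg; exists r => // x xr nUx.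
  have seg t : 0 <= t <= 1 -> crease (g + t *: (x - g)).
    move=> t0; have E : g + t *: (x - g) - g = t *: (x - g) by plane_ring.
    have [_ H] := hr (g + t *: (x - g)) ltac:(apply: convex_ball => //; rewrite subrr normr0 //).
    apply: H; rewrite E; transitivity (t * cross d (x - g)); first by dot_ring.
    have [H _] := hr x xr; suff -> : cross d (x - g) = 0 by rewrite mulr0.
    by apply/eqP/negPn/negP => /H.
  have Cx : crease x by have := seg 1; rewrite scale1r subrKC; apply; rewrite ler01 lexx.
  split=> -[u Cu uE]; exists u => //; last exact: attached_move seg.
  apply: (attached_move Cx uE) => t t0.
  have -> : x + t *: (g - x) = g + (1 - t) *: (x - g) by plane_ring.
  by apply: seg; lra.
have [r r0 hr] := near_vertex_attached Vg; exists r => // x xr nUx.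
have [-> //|xg] := eqVneq x g; have [Cx xgE] := hr x xg xr nUx.
split=> -[u Cu uE]; last by exists g => //; rewrite -(attached_vertex Vg uE).
exists g; last by split=> //; left.
by have [<- //|/edge] := attached_unique Cx uE xgE; apply.
Qed.

End Attachment.

Theorem lemma1 (R : realType) (phi : plane R -> plane R)
    (Hphi : local_flat_folding phi)
    (Hinfty : vertices (folding_graph phi) None) :
  ~ articulation_vertex (folding_graph phi) None.
Proof.
move=> [_]; apply=> -[a|] [b|] [Va an] [Vb bn];
  [|by case: bn|by case: an|by case: an].
pose adj := adjacent (remove_vertex (folding_graph phi) None).
(* The component of [a] without the vertex at infinity. *)
pose C w := clos_refl_trans _ adj (Some a) (Some w).
have edge e u w : segment_edge phi e u w -> C u -> C w.
  by move=> uw Cu; apply: rt_trans Cu _; apply: rt_step; exists e; split.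
have {}Va : vertex_point phi a := Va; have {}Vb : vertex_point phi b := Vb.
have [nUa _ _] := Va; have [nUb _ _] := Vb.
(* Attachment to a vertex in [C] is a label on the folded points; it holds at [a], hence at [b]. *)
have [|w Cw bw] := folded_label_constant Hphi
  (attached_locally_constant Hphi edge) Va nUa nUb.
  by exists a; [apply: rt_refl|split=> //; left].
by rewrite -(attached_vertex Vb bw).
Qed.
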